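(* Let $a\in(0,1)$ and $b>0$ with $a+b\ge1/2$, and let $m\in\mathbb{R}$. Define $M:\mathbb{R}_+^2\to\mathbb{R}_+$ by \[ M(x,y)=\left[\frac{1}{B(b,b)}\int_0^1\bigl(sx+(1-s)y\bigr)^a s^{b-1}(1-s)^{b-1}\,ds\right]^{1/a}. \] Then $M$ is Schur $m$-power convex on $\mathbb{R}_+^2=(0,\infty)^2$ if and only if $(a,b,m)\in E^+$, and $M$ is Schur $m$-power concave on $\mathbb{R}_+^2$ if and only if $(a,b,m)\in E^-$, where, with $m_0=\frac{a+2b}{1+2b}$, \[ E^+=\{m\le m_0\}\cap\Bigl(\{a+b\ge1>m\}\cup\{m<a+b<1\}\cup\{m=a+b\le\tfrac12\}\Bigr), \] \[ E^-=\{m\ge m_0\}\cap\Bigl(\{a+b\ge1,\ m\ge1\}\cup\{\tfrac12\le m=a+b<1\}\cup\{a+b<1,\ a+b<m\}\Bigr). \]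
   Context: $B(p,q)=\Gamma(p)\Gamma(q)/\Gamma(p+q)$ is the Beta function. Majorization: for $\mathbf{u},\mathbf{v}\in\mathbb{R}^n$, $\mathbf{u}\prec\mathbf{v}$ means $\sum_{i=1}^k u_{[i]}\le\sum_{i=1}^k v_{[i]}$ for $k=1,\dots,n-1$ and $\sum_{i=1}^n u_i=\sum_{i=1}^n v_i$, where $u_{[1]}\ge\cdots\ge u_{[n]}$ is the decreasing rearrangement. Schur $m$-power convexity: let $f:(0,\infty)\to\mathbb{R}$ be $f(x)=(x^m-1)/m$ if $m\ne0$ and $f(x)=\ln x$ if $m=0$; a function $\varphi:\Omega\subseteq\mathbb{R}_+^n\to\mathbb{R}$ is Schur $m$-power convex (resp. concave) on $\Omega$ if for all $\mathbf{x},\mathbf{y}\in\Omega$, $(f(x_1),\dots,f(x_n))\prec(f(y_1),\dots,f(y_n))$ implies $\varphi(\mathbf{x})\le\varphi(\mathbf{y})$ (resp. $\varphi(\mathbf{x})\ge\varphi(\mathbf{y})$). *)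

(* Defs.v *)
From HB Require Import structures.
From mathcomp Require Import all_boot all_order all_algebra.
From mathcomp Require Import all_classical all_reals all_analysis.
Set Implicit Arguments. Unset Strict Implicit. Unset Printing Implicit Defensive.
Import Order.TTheory GRing.Theory Num.Theory.
Local Open Scope classical_set_scope.
Local Open Scope ring_scope.

Section Defs.
Variable R : realType.

Definition Gammaf (p : R) : R :=
  Rintegral lebesgue_measure `]0, +oo[ (fun t : R => t `^ (p - 1) * expR (- t)).

Definition Betaf (p q : R) : R := Gammaf p * Gammaf q / Gammaf (p + q).

Definition Mab (a b x y : R) : R :=
  ((Betaf b b)^-1 *
    Rintegral lebesgue_measure `[0, 1]
      (fun s : R => (s * x + (1 - s) * y) `^ a * s `^ (b - 1) * (1 - s) `^ (b - 1)))
  `^ (a^-1).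

Definition decr_rearr (n : nat) (u : 'I_n -> R) : seq R :=
  sort (fun x y : R => y <= x) [seq u i | i <- enum 'I_n].

Definition majorized (n : nat) (u v : 'I_n -> R) : Prop :=
  (forall k : nat, (1 <= k <= n.-1)%N ->
     \sum_(i < k) nth 0 (decr_rearr u) i <= \sum_(i < k) nth 0 (decr_rearr v) i)
  /\ \sum_(i < n) u i = \sum_(i < n) v i.

Definition fpow (m x : R) : R := if m != 0 then (x `^ m - 1) / m else ln x.

Definition Schur_m_power_convex (m : R) (n : nat)
    (Omega : set ('I_n -> R)) (phi : ('I_n -> R) -> R) : Prop :=
  (forall x, Omega x -> forall i, 0 < x i) /\
  forall x y, Omega x -> Omega y ->
    majorized (fun i => fpow m (x i)) (fun i => fpow m (y i)) -> phi x <= phi y.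

Definition Schur_m_power_concave (m : R) (n : nat)
    (Omega : set ('I_n -> R)) (phi : ('I_n -> R) -> R) : Prop :=
  (forall x, Omega x -> forall i, 0 < x i) /\
  forall x y, Omega x -> Omega y ->
    majorized (fun i => fpow m (x i)) (fun i => fpow m (y i)) -> phi y <= phi x.

Definition pos_orthant (n : nat) : set ('I_n -> R) := [set x | forall i, 0 < x i].

Definition m0 (a b : R) : R := (a + 2 * b) / (1 + 2 * b).

Definition Eplus (a b m : R) : Prop :=
  m <= m0 a b /\
  ((1 <= a + b /\ m < 1) \/ (m < a + b /\ a + b < 1) \/ (m = a + b /\ a + b <= 1/2)).

Definition Eminus (a b m : R) : Prop :=
  m0 a b <= m /\
  ((1 <= a + b /\ 1 <= m) \/ (1/2 <= m /\ m = a + b /\ a + b < 1)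
   \/ (a + b < 1 /\ a + b < m)).

End Defs.

(* Main.v *)
(* On a curve f(x) + f(y) = const the majorization order is the order of the ratio r = x/y >= 1, so
   the claim is about the monotonicity in r of F(r)^(1/a) divided by the power mean of order m of
   (r, 1), where F(r) = int u^a w, u = s r + 1 - s and w = (s (1-s))^(b-1).  The derivative has the
   sign of N_m = r P - r^m Q with P = int s u^(a-1) w and Q = int (1-s) u^(a-1) w.
   Integration by parts gives (r-1) Q' = b (P - Q) (an Euler-Poisson-Darboux equation), whence
     (r^-a N_m)' = r^-a (- b (1 + r^m) N_m + Q S_m) / (r (r-1)),
     S_m = (a-m) r^m (r-1) + b (r - r^m) (1 + r^m).
   As N_m(1) = 0 and the coefficient of N_m is negative, N_m inherits a constant sign of S_m.  For
   m = m0 one has S_m >= 0, for m = min(1, a+b) one has S_m <= 0, and N_m decreases in m; under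
   a + b >= 1/2 the sets E+ and E- are {m <= m0} and {m >= min(1, a+b)}.  Optimality: for m > m0,
   S_m < 0 near r = 1; for m < min(1, a+b), N_m > 0 for large r by comparing P and Q with powers
   of r. *)
Require Import Defs.
From HB Require Import structures.
From mathcomp Require Import all_boot all_order all_algebra.
From mathcomp Require Import all_classical all_reals all_analysis.
From mathcomp Require Import measurable_realfun ring lra.
Import Order.TTheory GRing.Theory Num.Theory.
Import numFieldNormedType.Exports.
Local Open Scope classical_set_scope.
Local Open Scope ring_scope.

(** * Calculus on intervals *)

Section calculus.
Variable R : realType.
Implicit Types (f g F : R -> R).
Notation mu := (@lebesgue_measure R).

Lemma is_derive_continuous f (x l : R) : is_derive x 1 f l -> {for x, continuous f}.
Proof. by move=> H; apply/differentiable_continuous/derivable1_diffP; exact: ex_derive. Qed.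

(** Let [t] be the last point of [[a, b]] where [0 <= f]. If [f b < 0], then [f < 0] on []t, b]], so
    the derivative is nonnegative there and the mean value theorem gives [f t <= f b], a
    contradiction. Asking for the sign of [df] only where [f < 0] suits the differential equation of
    [gap]. *)
Lemma ge0_of_derive_ge0 f df (a b : R) : a <= b -> f a = 0 ->
  (forall x, a <= x <= b -> is_derive x 1 f (df x)) ->
  (forall x, a < x <= b -> f x < 0 -> 0 <= df x) -> 0 <= f b.
Proof.
move=> ab fa0 fd dfge0; rewrite leNgt; apply/negP => fb0.
have {}ab : a < b.
  by rewrite lt_neqAle ab andbT; apply: contraTN fb0 => /eqP <-; rewrite fa0 ltxx.
pose A := [set x | a <= x <= b /\ 0 <= f x].
have A0 : A !=set0 by exists a; rewrite /A /= lexx ltW// fa0.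
have ubA : ubound A b by move=> x [] /andP[].
have hA : has_sup A by split => //; exists b.
set t := sup A.
have tb : t <= b by exact: ge_sup.
have at_ : a <= t by apply: sup_upper_bound => //; rewrite /A/= lexx ltW// fa0.
have ft : 0 <= f t.
  rewrite leNgt; apply/negP => ft0.
  have : {for t, continuous f} by apply/is_derive_continuous/fd/andP.
  move/cvgr_lt => /(_ _ ft0) [e /= e0 He].
  have [x [] /andP[ax xb] fx] := sup_adherent e0 hA => tx.
  have xt : x <= t by apply: sup_upper_bound => //; split => //; rewrite ax.
  have := He x; rewrite /ball/= ger0_norm ?subr_ge0// ltrBlDl -ltrBlDr => /(_ tx).
  by rewrite ltNge fx.
have {}tb : t < b.
  by rewrite lt_neqAle tb andbT; apply: contraTN fb0 => /eqP <-; rewrite -leNgt.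
have fneg x : t < x -> x <= b -> f x < 0.
  move=> tx xb; rewrite ltNge; apply/negP => fx.
  have : x <= t by apply: sup_upper_bound => //; split => //; rewrite xb andbT (le_trans at_)// ltW.
  by rewrite leNgt tx.
have [||c] := @MVT _ f df t b tb.
- move=> x; rewrite in_itv/= => /andP[tx xb]; apply: fd.
  by rewrite (le_trans at_ (ltW tx)) ltW.
- apply: derivable_within_continuous => x; rewrite in_itv/= => /andP[tx xb].
  by apply: ex_derive; apply: fd; rewrite (le_trans at_ tx).
rewrite in_itv/= => /andP[tc cb] E.
have : 0 <= df c * (b - t).
  rewrite mulr_ge0// ?subr_ge0 ?(ltW tb)// dfge0 ?(le_lt_trans at_ tc) ?(ltW cb)//.
  by apply: fneg => //; exact: ltW.
by rewrite -E subr_ge0 leNgt (lt_le_trans fb0 ft).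
Qed.

Lemma integrable_itv_oo_cc f (x y : R) :
  mu.-integrable `]x, y[ (EFin \o f) -> mu.-integrable `[x, y] (EFin \o f).
Proof.
move=> /integrableP[mf fi]; apply/integrableP; split.
  exact/emeasurable_fun_itv_bndo_bndcP/emeasurable_fun_itv_obnd_cbndP.
by rewrite integral_itv_bndoo//; exact: measurableT_comp.
Qed.

Lemma Rintegral_oo_cc f (x y : R) : mu.-integrable `]x, y[ (EFin \o f) ->
  Rintegral mu `[x, y] f = Rintegral mu `]x, y[ f.
Proof.
by move=> /integrableP[mf _]; rewrite /Rintegral integral_itv_bndoo.
Qed.

(** The integrand may be unbounded at the endpoints, as the beta weight is for [b < 1]: the
    indefinite integral minus [F] has zero derivative inside and is continuous up to the ends, hence
    is constant. *)
Lemma Rintegral_derive f F (x y : R) : x < y ->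
  derivable_oo_LRcontinuous F x y -> {in `]x, y[, F^`()%classic =1 f} ->
  {in `]x, y[, continuous f} -> mu.-integrable `]x, y[ (EFin \o f) ->
  Rintegral mu `]x, y[ f = F y - F x.
Proof.
move=> xy FD Ff cf fi; have fi' := integrable_itv_oo_cc _ _ _ fi.
have [dF _ _] := FD.
pose G t := Rintegral mu `[x, t] f.
have dG t : t \in `]x, y[ -> is_derive t 1 G (f t).
  move=> txy; have [xt ty] : x < t /\ t < y by rewrite !(itvP txy).
  have [] := @continuous_FTC1_closed R f x t y ty fi' xt; first exact: cf.
  by move=> d1 d2; apply: DeriveDef => //; rewrite -derive1E.
have [||c _] := @MVT _ (G \- F) (cst 0) x y xy.
- move=> t txy; rewrite /cst -(subrr (f t)); apply: is_deriveB; first exact: dG.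
  by apply: DeriveDef; [exact: dF|rewrite -derive1E Ff].
- move=> t; apply: continuousB.
    by apply: (@parameterized_integral_continuous R x y f (ltW xy) fi').
  by apply: derivable_oo_LRcontinuous_within.
rewrite /cst mul0r /= /G set_itv1 Rintegral_set1 -Rintegral_oo_cc//; lra.
Qed.

(** Monotone convergence along [[1/(n+1), 1]], where the primitive [p^-1 s^p] bounds every integral
    by [p^-1]. *)
Lemma integrable_powRB1 (p : R) : 0 < p ->
  mu.-integrable `]0, 1[ (EFin \o (fun s => s `^ (p - 1))).
Proof.
move=> p0; pose f (s : R) := s `^ (p - 1).
have mf D : measurable_fun D (EFin \o f).
  by apply/measurable_EFinP; apply: measurable_funTS; exact: measurable_powR.
have fge0 (D : set R) x : D x -> (0 <= (f x)%:E)%E by rewrite lee_fin powR_ge0.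
pose A n := `[(n.+1%:R^-1 : R), 1]%classic.
suff : (\int[mu]_(x in \bigcup_n A n) (f x)%:E <= (p^-1)%:E)%E.
  move=> H; apply/integrableP; split; first exact: mf.
  apply: (@le_lt_trans _ _ (p^-1)%:E); last exact: ltry.
  apply: (le_trans _ H).
  under eq_integral do rewrite gee0_abs ?lee_fin ?powR_ge0//.
  apply: ge0_subset_integral => //.
    by apply: bigcup_measurable => k _; exact: measurable_itv.
  exact: mf.
    by move=> x _; rewrite lee_fin powR_ge0.
  move=> x /=; rewrite in_itv/= => /andP[x0 x1].
  (* This index works since [x^-1 < truncn (x^-1) + 1]. *)
  exists (Num.truncn (x^-1)) => //; rewrite /A/= in_itv/= (ltW x1) andbT.
  by rewrite -[leRHS]invrK lef_pV2 ?posrE ?invr_gt0// ltW// truncnS_gt.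
have nd : nondecreasing_seq A.
  apply/nondecreasing_seqP => n; rewrite subsetEset; rewrite /A; apply: subset_itvr.
  by rewrite bnd_simp lef_pV2 ?posrE// ler_nat.
have mA n : measurable (A n) by exact: measurable_itv.
have /cvg_lim <- // : (\int[mu]_(x in A n) (f x)%:E @[n --> \oo] -->
    \int[mu]_(x in \bigcup_n A n) (f x)%:E)%E.
  by apply: ge0_nondecreasing_set_cvg_integral => // n; [exact: mf|move=> x _; exact: fge0].
apply: lime_le.
  apply: ereal_nondecreasing_is_cvgn.
  by apply: ge0_nondecreasing_set_nondecreasing_integral => // n; [exact: mf|move=> x _; exact: fge0].
apply: nearW => n; rewrite /A /=.
have n0 : 0 < (n.+1%:R^-1 : R) by rewrite invr_gt0.
have dp (x : R) : 0 < x -> is_derive x 1 (fun s : R => p^-1 * s `^ p) (f x).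
  move=> x0; have -> : f x = p^-1 * (p * x `^ (p - 1)) by rewrite mulrA mulVf ?mul1r ?gt_eqF.
  by apply: is_deriveZ; exact: is_derive1_powR.
have [->|n1] := eqVneq n 0%N.
  by rewrite invr1 set_itv1 integral_set1 lee_fin invr_ge0 ltW.
have {}n1 : (n.+1%:R^-1 : R) < 1 by rewrite invf_lt1// ltr1n ltnS lt0n.
have cont g (x : R) l : is_derive x 1 g l -> g y @[y --> x] --> g x by exact: is_derive_continuous.
have dE (x : R) : 0 < x -> exists l, is_derive x 1 f l.
  by move=> x0; eexists; exact: is_derive1_powR.
rewrite (@continuous_FTC2 _ f (fun s : R => p^-1 * s `^ p))//.
- rewrite -EFinB lee_fin powR1 mulr1 gerBl mulr_ge0 ?powR_ge0// invr_ge0 ltW//.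
- apply: derivable_within_continuous => x; rewrite in_itv/= => /andP[nx _].
  by have [l dl] := dE x (lt_le_trans n0 nx); exact: ex_derive.
- split.
  + by move=> x; rewrite in_itv/= => /andP[nx _]; apply: ex_derive; apply: dp; exact: lt_trans nx.
  + by apply: cvg_at_right_filter; apply: cont; exact: dp.
  + by apply: cvg_at_left_filter; apply: cont; exact: dp.
- move=> x; rewrite in_itv/= => /andP[nx _]; rewrite derive1E; apply: derive_val; apply: dp.
  exact: lt_trans nx.
Qed.

End calculus.

(** * Integrals of powers of a chord against a weight *)

Section beta_weight.
Variable R : realType.
Implicit Types (f g h : R -> R).
Notation mu := (@lebesgue_measure R).
Notation D := (`]0, 1[%classic : set R).

(** Lebesgue measure is determined by its values on half-open intervals, and the reflection
    preserves lengths. *)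
Lemma lebesgue_measure_onem (A : set R) : measurable A ->
  pushforward mu ((fun x => 1 - x) : R -> measurableTypeR R) A = mu A.
Proof.
have mo : measurable_fun setT ((fun x => 1 - x) : R -> measurableTypeR R).
  by apply: measurable_funB => //; exact: measurable_cst.
pose o_mixin := isMeasurableFun.Build _ _ _ _ _ mo.
pose o_pack : {mfun _ >-> _} := HB.pack ((fun x => 1 - x) : R -> measurableTypeR R) o_mixin.
move=> mA; apply/esym.
apply: (@lebesgue_measure_unique R (pushforward mu o_pack)) => //= _ [[a b]] _ <-.
rewrite /pushforward.
have -> : (fun x : R => 1 - x) @^-1` `]a, b] = `[1 - b, 1 - a[%classic.
  by apply/seteqP; split => x /=; rewrite !in_itv/= => /andP[]; lra.
rewrite !lebesgue_measure_itv/= !lte_fin ltrD2l ltrN2.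
by case: ifPn => // _; rewrite -!EFinB; congr EFin; lra.
Qed.

Lemma ge0_integral_onem f : measurable_fun D f -> (forall s, D s -> 0 <= f s) ->
  (\int[mu]_(s in D) (f (1 - s))%:E = \int[mu]_(s in D) (f s)%:E)%E.
Proof.
move=> mf f0; have mo : measurable_fun setT ((fun x => 1 - x) : R -> measurableTypeR R).
  by apply: measurable_funB => //; exact: measurable_cst.
have DE : D = ((fun x => 1 - x) : R -> measurableTypeR R) @^-1` D.
  by apply/seteqP; split => x /=; rewrite !in_itv/= => /andP[]; lra.
transitivity (\int[pushforward mu ((fun x => (1 - x)%R) : R -> measurableTypeR R)]_(s in D) (f s)%:E)%E.
  rewrite [in LHS]DE ge0_integral_pushforward//; first exact/measurable_EFinP.
  by move=> y; rewrite inE => Dy; rewrite lee_fin f0.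
by apply: eq_measure_integral => //= A mA AS; exact: lebesgue_measure_onem.
Qed.

Lemma integrableM_bounded (A : set R) f g (C : R) : measurable A ->
  measurable_fun A f -> (forall s, A s -> `|f s| <= C) ->
  mu.-integrable A (EFin \o g) -> mu.-integrable A (EFin \o (fun s => f s * g s)).
Proof.
move=> mA mf fC gi; have -> : EFin \o (fun s => f s * g s) = ((EFin \o f) \* (EFin \o g))%E.
  by apply/funext => s /=; rewrite EFinM.
apply: integrableMr => //; exists C; split; first exact: num_real.
by move=> M CM s As; apply: (le_trans (fC _ As)); exact: ltW.
Qed.

(** If the integral were [0], then [f] would vanish almost everywhere on [A], and [A] would lie in a
    null set. *)
Lemma Rintegral_gt0 (A : set R) f : measurable A -> (0 < mu A)%E ->
  mu.-integrable A (EFin \o f) -> (forall s, A s -> 0 < f s) -> 0 < Rintegral mu A f.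
Proof.
move=> mA A0 fi f0; rewrite lt_neqAle Rintegral_ge0 ?andbT; last by move=> s /f0/ltW.
apply/eqP => E0; have [mf _] := integrableP _ _ _ fi.
have : (\int[mu]_(x in A) `|(f x)%:E| = 0)%E.
  transitivity (\int[mu]_(x in A) (f x)%:E)%E.
    by apply: eq_integral => x; rewrite inE => Ax; rewrite gee0_abs// lee_fin ltW ?f0.
  by rewrite -[LHS]fineK ?integrable_fin_num// -/(Rintegral _ _ _) -E0.
move=> /(ae_eq_integral_abs mu mA mf)[N [mN N0 AN]].
have : (mu A <= mu N)%E.
  apply: le_measure; rewrite ?inE// => x Ax; apply: AN => /= /(_ Ax)/eqP.
  by rewrite eqe gt_eqF// f0.
by rewrite N0 leNgt A0.
Qed.

(** The power is monotone in [u], in a direction that depends on the sign of [e]; the sum of both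
    end values is a bound for either sign. *)
Lemma powR_le_sum (A B u e : R) : 0 < A -> A <= u <= B -> u `^ e <= A `^ e + B `^ e.
Proof.
move=> A0 /andP[Au uB]; have u0 := lt_le_trans A0 Au; have B0 := lt_le_trans u0 uB.
have [e0|e0] := leP 0 e.
  by rewrite ler_wpDl ?powR_ge0// ge0_ler_powR ?nnegrE// ltW.
rewrite ler_wpDr ?powR_ge0// -[e]opprK !(powRN _ (- e)) lef_pV2 ?posrE ?powR_gt0//.
by rewrite ge0_ler_powR ?nnegrE ?oppr_ge0// ltW.
Qed.

(** On each half of []0, 1[] only one factor can be singular and the other is bounded by a constant
    [c], so the sum [g] of the two one-sided singular terms dominates. *)
Lemma integrable_beta (p q : R) : 0 < p -> 0 < q ->
  mu.-integrable D (EFin \o (fun s => s `^ (p - 1) * (1 - s) `^ (q - 1))).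
Proof.
move=> p0 q0.
have m1 t : measurable_fun D (fun s : R => s `^ t) by apply: measurable_funTS; exact: measurable_powR.
have m2 t : measurable_fun D (fun s : R => (1 - s) `^ t).
  apply: (@measurableT_comp _ _ _ _ _ _ (@powR R ^~ t)) => //.
  by apply: measurable_funB => //; exact: measurable_cst.
have i2 : mu.-integrable D (EFin \o (fun s : R => (1 - s) `^ (q - 1))).
  have [_ H] := integrableP _ _ _ (integrable_powRB1 R q q0).
  apply/integrableP; split; first by apply/measurable_EFinP; exact: m2.
  apply: le_lt_trans H; rewrite -(@ge0_integral_onem (fun s => `|s `^ (q - 1)|))//.
  exact: measurableT_comp.
pose c t : R := 2^-1 `^ (t - 1) + 1 `^ (t - 1).
have bnd t (s : R) : 2^-1 <= s <= 1 -> s `^ (t - 1) <= c t by exact: powR_le_sum.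
have c0 t : 0 <= c t by rewrite addr_ge0// powR_ge0.
pose u1 s : R := s `^ (p - 1); pose u2 s : R := (1 - s) `^ (q - 1).
pose g s : R := c q * s `^ (p - 1) + c p * (1 - s) `^ (q - 1).
have gi : mu.-integrable D (EFin \o g).
  have -> : EFin \o g = ((fun s => (c q)%:E * (u1 s)%:E) \+
      (fun s => (c p)%:E * (u2 s)%:E))%E.
    by apply/funext => s.
  by apply: integrableD => //; apply: integrableZl => //; exact: integrable_powRB1.
apply: (le_integrable _ _ _ gi) => //.
  by apply/measurable_EFinP; apply: measurable_funM; [exact: m1|exact: m2].
move=> s; rewrite /= in_itv/= => /andP[s0 s1].
rewrite lee_fin !ger0_norm ?addr_ge0 ?mulr_ge0 ?powR_ge0// /g.
have [h|h] := leP s 2^-1.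
  rewrite ler_wpDr ?mulr_ge0 ?powR_ge0// mulrC ler_wpM2r ?powR_ge0// bnd//; lra.
rewrite ler_wpDl ?mulr_ge0 ?powR_ge0// ler_wpM2r ?powR_ge0// bnd//; lra.
Qed.

(** By homogeneity a pair [(x, y)] is reduced to [(x / y, 1)]; this is the point [u] between [1] and
    [r = x / y]. *)
Definition chord (r s : R) : R := s * r + (1 - s).

Lemma chord_gt0 (r s : R) : 0 < r -> D s -> 0 < chord r s.
Proof. by move=> r0; rewrite /= in_itv/= /chord => /andP[s0 s1]; nra. Qed.

Lemma measurable_chord (r e : R) A : measurable_fun A (fun s => chord r s `^ e).
Proof.
apply: measurable_funTS; apply: (@measurableT_comp _ _ _ _ _ _ (@powR R ^~ e)) => //.
by apply: measurable_funD; [exact: measurable_funM|apply: measurable_funB => //; exact: measurable_cst].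
Qed.

(** The chord stays between [min r1 1] and [max r2 1]. Uniformity in [r] supplies the domination
    needed to differentiate under the integral. *)
Lemma chord_powR_bound (r1 r2 e : R) : 0 < r1 -> exists C, forall r s,
  r1 <= r <= r2 -> D s -> `|chord r s `^ e| <= C.
Proof.
move=> r10; exists (Num.min r1 1 `^ e + Num.max r2 1 `^ e) => r s /andP[r1r rr2].
rewrite /= in_itv/= => /andP[s0 s1]; rewrite ger0_norm ?powR_ge0//.
apply: powR_le_sum; first by rewrite lt_min r10 ltr01.
have : Num.min r1 1 <= r1 /\ Num.min r1 1 <= 1 by rewrite !ge_min !lexx orbT.
have : r2 <= Num.max r2 1 /\ 1 <= Num.max r2 1 by rewrite !le_max !lexx orbT.
by rewrite /chord; move=> [? ?] [? ?]; nra.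
Qed.

Lemma integrable_chord (r e : R) g : 0 < r -> mu.-integrable D (EFin \o g) ->
  mu.-integrable D (EFin \o (fun s => chord r s `^ e * g s)).
Proof.
move=> r0 gi; have [C HC] := chord_powR_bound r r e r0.
apply: (integrableM_bounded _ _ _ C) => //; first exact: measurable_chord.
by move=> s Ds; apply: HC => //; rewrite lexx.
Qed.

Lemma integrable_mul_id g : mu.-integrable D (EFin \o g) ->
  mu.-integrable D (EFin \o (fun s => s * g s)).
Proof.
apply: (integrableM_bounded _ _ _ 1) => // s; rewrite /= in_itv/= => /andP[s0 s1].
by rewrite ger0_norm ltW.
Qed.

Lemma integrable_mul_onem g : mu.-integrable D (EFin \o g) ->
  mu.-integrable D (EFin \o (fun s => (1 - s) * g s)).
Proof.
apply: (integrableM_bounded _ _ _ 1) => //.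
  by apply: measurable_funB => //; exact: measurable_cst.
by move=> s; rewrite /= in_itv/= => /andP[s0 s1]; rewrite ger0_norm; lra.
Qed.

Definition chord_int (e : R) g (r : R) := Rintegral mu D (fun s => chord r s `^ e * g s).

Lemma is_derive_chord_int (e r : R) g : 0 < r -> mu.-integrable D (EFin \o g) ->
  is_derive r 1 (chord_int e g) (e * chord_int (e - 1) (fun s => s * g s) r).
Proof.
move=> r0 gi; pose f x s := chord x s `^ e * g s.
have fd (x s : R) : 0 < x -> D s ->
    is_derive x 1 (f ^~ s) (e * (chord x s `^ (e - 1) * (s * g s))).
  move=> x0 Ds; have c0 := chord_gt0 _ _ x0 Ds.
  have h : is_derive x 1 (fun y => chord y s) s.
    have -> : (fun y => chord y s) = (fun y => s * y) \+ cst (1 - s) by [].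
    rewrite -[X in is_derive _ _ _ X]addr0; apply: is_deriveD.
    by rewrite -[X in is_derive _ _ _ X]mulr1; exact: is_deriveZ.
  have h2 := @is_derive1_comp _ (@powR R ^~ e) (fun y => chord y s) x _ _
     (is_derive1_powR e c0) h.
  have h3 := @is_deriveZ _ _ _ _ (g s) _ _ _ h2.
  have -> : f ^~ s = g s \*: ((@powR R ^~ e) \o (fun y => chord y s)).
    by apply/funext => y; rewrite /f mulrC.
  apply: is_derive_eq; rewrite /GRing.scale/=; ring.
have [C HC] := chord_powR_bound (r / 2) (r * 2) (e - 1) (divr_gt0 r0 (ltr0n _ 2)).
have Ir : r \in `]r / 2, r * 2[%R by rewrite in_itv/=; apply/andP; split; lra.
have pos x : `]r / 2, r * 2[%classic x -> 0 < x.
  by rewrite /= in_itv/= => /andP[]; lra.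
(* The dominating function for the partial derivative in [r], valid on the whole neighbourhood []r /
   2, 2 r[]; the extra factor [s] is at most [1]. *)
pose G s := `|e| * (C * `|g s|).
have C0 : 0 <= C.
  apply: le_trans (HC r 2^-1 _ _) => //; first by lra.
  by rewrite /= in_itv/=; lra.
have h1 x : `]r / 2, r * 2[%classic x -> mu.-integrable D (EFin \o f x).
  by move=> /pos x0; exact: integrable_chord.
have h2 x s : `]r / 2, r * 2[%classic x -> D s -> derivable (f ^~ s) x 1.
  by move=> /pos x0 Ds; apply: ex_derive; exact: fd.
have h3 s : 0 <= G s by rewrite /G !mulr_ge0.
have h4 : mu.-integrable D (EFin \o G).
  have -> : EFin \o G = (fun s => (`|e| * C)%:E * `|(EFin \o g) s|)%E.
    by apply/funext => s; rewrite /G /= -EFinM mulrA.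
  by apply: integrableZl => //; exact: integrable_abse.
have h5 x s : `]r / 2, r * 2[%classic x -> D s -> `|partial1of2 f x s| <= G s.
  move=> Ix Ds; rewrite /partial1of2 derive1E.
  have -> := @derive_val _ _ _ _ _ _ _ (fd x s (pos _ Ix) Ds).
  rewrite /G normrM ler_wpM2l// normrM ler_pM// ?HC//.
    by move: Ix; rewrite /= in_itv/= => /andP[? ?]; rewrite !ltW.
  move: Ds; rewrite /= in_itv/= => /andP[s0 s1].
  by rewrite normrM (ger0_norm (ltW s0)) ler_piMl// ltW.
have mD : measurable D by [].
have dF := @derivable_under_integral _ _ _ mu f D mD r _ _ Ir h1 h2 G h3 h4 h5.
have eF := @differentiation_under_integral _ _ _ mu f D mD r _ _ Ir h1 h2 G h3 h4 h5.
apply: DeriveDef; first exact: dF.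
rewrite -derive1E eF /chord_int -RintegralZl//; last first.
  by apply: integrable_chord => //; exact: integrable_mul_id.
apply: eq_Rintegral => s; rewrite inE => Ds; rewrite /partial1of2 derive1E.
exact: (@derive_val _ _ _ _ _ _ _ (fd r s r0 Ds)).
Qed.

End beta_weight.

(** * The beta mean and its partial derivatives *)

Section beta_mean.
Variable R : realType.
Implicit Types (f g h : R -> R) (e r s : R).
Notation mu := (@lebesgue_measure R).
Notation D := (`]0, 1[%classic : set R).

Lemma powRS (x e : R) : 0 < x -> x `^ e = x * x `^ (e - 1).
Proof.
by move=> x0; rewrite -{2}[x]powRr1 ?ltW// -powRD ?subrKC// (gt_eqF x0) implybT.
Qed.

Lemma integrableD_EFin (A : set R) f g : measurable A ->
  mu.-integrable A (EFin \o f) -> mu.-integrable A (EFin \o g) ->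
  mu.-integrable A (EFin \o (fun s => f s + g s)).
Proof.
move=> mA fi gi; have -> : EFin \o (fun s => f s + g s) = ((EFin \o f) \+ (EFin \o g))%E by [].
exact: integrableD.
Qed.

Lemma integrableZ_EFin (A : set R) f k : measurable A ->
  mu.-integrable A (EFin \o f) -> mu.-integrable A (EFin \o (fun s => k * f s)).
Proof.
move=> mA fi.
have -> : EFin \o (fun s => k * f s) = (fun s => (k%:E * (EFin \o f) s)%E) by [].
exact: integrableZl.
Qed.

Lemma is_derive_powR_onem (e s : R) : s < 1 ->
  is_derive s 1 (fun t : R => (1 - t) `^ e) (- (e * (1 - s) `^ (e - 1))).
Proof.
move=> s1; have h0 : 0 < 1 - s by rewrite subr_gt0.
have h1 : is_derive s 1 (fun t : R => 1 - t) (-1).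
  rewrite -[X in is_derive _ _ _ X]add0r; exact: is_deriveB.
have := @is_derive1_comp _ (@powR R ^~ e) (fun t => 1 - t) s _ _ (is_derive1_powR e h0) h1.
by rewrite mulrN1.
Qed.

Lemma is_derive_powR_chord (r e s : R) : 0 < chord _ r s ->
  is_derive s 1 (fun t : R => chord _ r t `^ e) (e * chord _ r s `^ (e - 1) * (r - 1)).
Proof.
move=> c0.
have h1 : is_derive s 1 (fun t : R => chord _ r t) (r - 1).
  have -> : (fun t => chord _ r t) = (fun t => (r - 1) * t) \+ cst (1 : R).
    by apply/funext => t; rewrite /chord /=; ring.
  rewrite -[X in is_derive _ _ _ X]addr0; apply: is_deriveD.
  by rewrite -[X in is_derive _ _ _ X]mulr1; exact: is_deriveZ.
exact: (@is_derive1_comp _ (@powR R ^~ e) _ s _ _ (is_derive1_powR e c0) h1).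
Qed.

Variables a b : R.
Hypotheses (a0 : 0 < a) (a1 : a < 1) (b0 : 0 < b).

Definition beta_weight (s : R) : R := s `^ (b - 1) * (1 - s) `^ (b - 1).
Notation w := beta_weight.

(* [meanF] is the integral in [M(r, 1)], without normalization; [a * meanP] and [a * meanQ] are
   the partial derivatives of [(x, y) |-> y^a * meanF (x / y)] at [(r, 1)]. *)
Definition meanF := chord_int R a w.
Definition meanP := chord_int R (a - 1) (fun s => s * w s).
Definition meanQ := chord_int R (a - 1) (fun s => (1 - s) * w s).
(** Up to the factor [a - 1] this is the derivative of [meanQ]. It also enters that of [meanP], and
    [meanQP] eliminates it. *)
Definition meanY := chord_int R (a - 1 - 1) (fun s => s * ((1 - s) * w s)).

Let wi : mu.-integrable D (EFin \o w).
Proof. exact: integrable_beta. Qed.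

Let swi : mu.-integrable D (EFin \o (fun s => s * w s)).
Proof. exact: integrable_mul_id. Qed.

Let twi : mu.-integrable D (EFin \o (fun s => (1 - s) * w s)).
Proof. exact: integrable_mul_onem. Qed.

Let stwi : mu.-integrable D (EFin \o (fun s => s * ((1 - s) * w s))).
Proof. exact: integrable_mul_id. Qed.

Let mD : measurable D. Proof. by []. Qed.

Lemma weight_gt0 s : D s -> 0 < w s.
Proof. by rewrite /= in_itv/= => /andP[s0 s1]; rewrite mulr_gt0// powR_gt0// subr_gt0. Qed.

Lemma chord_int_gt0 e g r : 0 < r -> mu.-integrable D (EFin \o g) ->
  (forall s, D s -> 0 < g s) -> 0 < chord_int R e g r.
Proof.
move=> r0 gi g0; apply: Rintegral_gt0 => //.
- by rewrite lebesgue_measure_itv/= lte_fin ltr01 -EFinB lte_fin subr0.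
- exact: integrable_chord.
- by move=> s Ds; rewrite mulr_gt0 ?g0// powR_gt0// chord_gt0.
Qed.

Lemma meanF_gt0 r : 0 < r -> 0 < meanF r.
Proof. by move=> r0; apply: chord_int_gt0 => //; exact: weight_gt0. Qed.

Lemma meanP_gt0 r : 0 < r -> 0 < meanP r.
Proof.
move=> r0; apply: chord_int_gt0 => // s Ds; rewrite mulr_gt0 ?weight_gt0//.
by move: Ds; rewrite /= in_itv/= => /andP[].
Qed.

Lemma meanQ_gt0 r : 0 < r -> 0 < meanQ r.
Proof.
move=> r0; apply: chord_int_gt0 => // s Ds; rewrite mulr_gt0 ?weight_gt0//.
by move: Ds; rewrite /= in_itv/= subr_gt0 => /andP[].
Qed.

(** One factor [u = s r + (1 - s)] is split off from [u^e]. *)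
Lemma chord_int_split e g r : 0 < r -> mu.-integrable D (EFin \o g) ->
  chord_int R e g r =
  r * chord_int R (e - 1) (fun s => s * g s) r + chord_int R (e - 1) (fun s => (1 - s) * g s) r.
Proof.
move=> r0 gi; have gi1 := integrable_mul_id _ _ gi; have gi2 := integrable_mul_onem _ _ gi.
rewrite /chord_int -RintegralZl//; last exact: integrable_chord.
rewrite -RintegralD//; last 2 first.
- by apply: integrableZ_EFin => //; exact: integrable_chord.
- exact: integrable_chord.
apply: eq_Rintegral => s; rewrite inE => Ds.
by rewrite (powRS _ e (chord_gt0 _ _ _ r0 Ds)) {1}/chord; ring.
Qed.

Lemma meanFE r : 0 < r -> meanF r = r * meanP r + meanQ r.
Proof. by move=> r0; rewrite /meanF chord_int_split. Qed.

Lemma is_derive_meanF r : 0 < r -> is_derive r 1 meanF (a * meanP r).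
Proof. by move=> r0; exact: is_derive_chord_int. Qed.

Lemma is_derive_meanQ r : 0 < r -> is_derive r 1 meanQ ((a - 1) * meanY r).
Proof. by move=> r0; exact: is_derive_chord_int. Qed.

(** Differentiation produces an integral with the weight [s^2 w]; splitting [meanP] by
    [chord_int_split] expresses it through [meanP] and [meanY]. *)
Lemma is_derive_meanP r : 0 < r ->
  is_derive r 1 meanP ((a - 1) * ((meanP r - meanY r) / r)).
Proof.
move=> r0; have := is_derive_chord_int _ (a - 1) r _ r0 swi.
move=> H; apply: (is_derive_eq H); congr (_ * _); rewrite /meanP [in RHS]chord_int_split//.
have -> : meanY r = chord_int R (a - 1 - 1) (fun s => (1 - s) * (s * w s)) r.
  by apply: eq_Rintegral => s _; ring.
by field; rewrite gt_eqF.
Qed.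

(** At [r = 1] the chord is constant, and [s -> 1 - s] exchanges the two integrands. *)
Lemma meanPQ1 : meanP 1 = meanQ 1.
Proof.
pose f s := chord R 1 s `^ (a - 1) * ((1 - s) * w s).
have /integrableP[/measurable_EFinP mf _] : mu.-integrable D (EFin \o f).
  by apply: integrable_chord.
have f0 s : D s -> 0 <= f s.
  rewrite /= in_itv/= => /andP[s0 s1].
  by rewrite /f !mulr_ge0 ?powR_ge0// subr_ge0 ltW.
rewrite /meanP /meanQ /chord_int /Rintegral -(ge0_integral_onem _ _ mf f0).
congr fine; apply: eq_integral => s _; congr EFin; rewrite /f.
have c1 t : chord R 1 t = 1 by rewrite /chord; ring.
rewrite !c1 powR1 /w; have -> : 1 - (1 - s) = s by ring.
by rewrite !mul1r (mulrC (s `^ _)).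
Qed.

(** The reflection [s -> 1 - s] fixes the weight and turns the chord of [r^-1] into [r^-1] times the
    chord of [r]. *)
Lemma meanF_sym r : 0 < r -> meanF r^-1 = r `^ (- a) * meanF r.
Proof.
move=> r0; have ri0 : 0 < r^-1 by rewrite invr_gt0.
pose f s := chord R r^-1 s `^ a * w s.
have /integrableP[/measurable_EFinP mf _] : mu.-integrable D (EFin \o f).
  by apply: integrable_chord.
have f0 s : D s -> 0 <= f s.
  by move=> Ds; rewrite /f mulr_ge0 ?powR_ge0// ltW ?weight_gt0.
rewrite /meanF /chord_int -RintegralZl//; last exact: integrable_chord.
rewrite /Rintegral -(ge0_integral_onem _ _ mf f0).
congr fine; apply: eq_integral => s; rewrite inE => Ds; congr EFin; rewrite /f.
have -> : chord _ r^-1 (1 - s) = r^-1 * chord _ r s by rewrite /chord; field; rewrite gt_eqF.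
rewrite powRM ?(ltW (chord_gt0 _ _ _ r0 Ds)) ?(ltW ri0)//.
rewrite -(powR_inv1 (ltW r0)) -powRrM mulN1r /w.
have -> : 1 - (1 - s) = s by ring.
by ring.
Qed.

(* Integration by parts: the derivative of [s^b (1-s)^b u^(a-1)], where [u = chord r s], has
   integral 0. *)
Lemma meanQP r : 0 < r -> b * (meanQ r - meanP r) = (1 - a) * (r - 1) * meanY r.
Proof.
move=> r0.
pose c s := chord _ r s.
pose G s : R := s `^ b * ((1 - s) `^ b * c s `^ (a - 1)).
pose f s : R := s `^ b * ((1 - s) `^ b * ((a - 1) * c s `^ (a - 1 - 1) * (r - 1)) +
    c s `^ (a - 1) * - (b * (1 - s) `^ (b - 1))) +
   ((1 - s) `^ b * c s `^ (a - 1)) * (b * s `^ (b - 1)).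
have c_gt0 (s : R) : 0 <= s <= 1 -> 0 < c s by rewrite /c /chord => /andP[? ?]; nra.
have dG (s : R) : s \in `]0, 1[ -> is_derive s 1 G (f s).
  rewrite in_itv/= => /andP[s0 s1].
  have h1 : is_derive s 1 (@powR R ^~ b) _ := is_derive1_powR b s0.
  have h2 := is_derive_powR_onem b s s1.
  have h3 : is_derive s 1 (fun t : R => c t `^ (a - 1)) _ :=
    is_derive_powR_chord r (a - 1) s (c_gt0 s (introT andP (conj (ltW s0) (ltW s1)))).
  exact: (is_deriveM h1 (is_deriveM h2 h3)).
have cc (s e : R) : 0 <= s <= 1 -> {for s, continuous (fun t : R => c t `^ e)}.
  by move=> s01; apply: is_derive_continuous (is_derive_powR_chord _ _ _ (c_gt0 _ s01)).
have c1 (s e : R) : 0 < s -> {for s, continuous (fun t : R => t `^ e)}.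
  by move=> s0; apply: is_derive_continuous (is_derive1_powR e s0).
have c2 (s e : R) : s < 1 -> {for s, continuous (fun t : R => (1 - t) `^ e)}.
  by move=> s0; apply: is_derive_continuous (is_derive_powR_onem e s s0).
(* For [b < 1] the power [(1 - t)^b] is not differentiable at [1]; its one-sided limit there is [0]
   because [b > 0]. *)
have cvg1 : (1 - t) `^ b @[t --> (1:R)^'-] --> 0.
  apply/cvgrPdist_lt => e e0; have /cvgrPdist_lt/(_ e e0)[d /= d0 H] := powR_cvg0 b0.
  exists d => //= s /= sd s1; apply: H; last by rewrite subr_gt0.
  by rewrite /= sub0r normrN.
have GD : derivable_oo_LRcontinuous G 0 1.
  split; first by move=> s /dG ds; exact: ex_derive.
    have -> : G 0 = 0 * ((1 - 0) `^ b * c 0 `^ (a - 1)) by rewrite /G powR0 ?gt_eqF.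
    apply: cvgM; first exact: powR_cvg0.
    by apply: cvgM; apply: cvg_at_right_filter; [exact: c2|apply: cc; rewrite lexx ler01].
  have -> : G 1 = 1 `^ b * (0 * c 1 `^ (a - 1)) by rewrite /G subrr powR0 ?gt_eqF.
  apply: cvgM; first by apply: cvg_at_left_filter; exact: c1.
  apply: cvgM; first exact: cvg1.
  by apply: cvg_at_left_filter; apply: cc; rewrite lexx ler01.
pose t1 s : R := c s `^ (a - 1) * ((1 - s) * w s).
pose t2 s : R := c s `^ (a - 1) * (s * w s).
pose t3 s : R := c s `^ (a - 1 - 1) * (s * ((1 - s) * w s)).
have i1 : mu.-integrable D (EFin \o t1) by exact: integrable_chord.
have i2 : mu.-integrable D (EFin \o t2) by exact: integrable_chord.
have i3 : mu.-integrable D (EFin \o t3) by exact: integrable_chord.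
(* Taking one factor out of [s^b] and [(1 - s)^b] turns [f] into a combination of the integrands of
   [meanQ], [meanP] and [meanY]. *)
have fE (s : R) : D s -> f s = b * t1 s + (- b * t2 s + (a - 1) * (r - 1) * t3 s).
  rewrite /= in_itv/= => /andP[s0 s1]; have s1' : 0 < 1 - s by rewrite subr_gt0.
  by rewrite /f /t1 /t2 /t3 /w (powRS s b s0) (powRS (1 - s) b s1'); ring.
have i4 : mu.-integrable D (EFin \o (fun s => - b * t2 s + (a - 1) * (r - 1) * t3 s)).
  by apply: integrableD_EFin => //; exact: integrableZ_EFin.
have fi : mu.-integrable D (EFin \o f).
  have : mu.-integrable D (EFin \o (fun s => b * t1 s + (- b * t2 s + (a - 1) * (r - 1) * t3 s))).
    by apply: integrableD_EFin => //; exact: integrableZ_EFin.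
  by apply: eq_integrable => // s; rewrite inE => Ds /=; rewrite fE.
have := @Rintegral_derive R f G 0 1 ltr01 GD.
have -> : G 1 - G 0 = 0 by rewrite /G subrr powR0 ?gt_eqF//; ring.
have -> : Rintegral mu D f = b * meanQ r + (- b * meanP r + (a - 1) * (r - 1) * meanY r).
  rewrite /meanQ /meanP /meanY /chord_int -/t1 -/t2 -/t3 -!RintegralZl//.
  rewrite -RintegralD//; [|exact: integrableZ_EFin|exact: integrableZ_EFin].
  rewrite -RintegralD//; [|exact: integrableZ_EFin].
  apply: eq_Rintegral => s; rewrite inE => Ds. exact: fE.
move=> H; have {H} : b * meanQ r + (- b * meanP r + (a - 1) * (r - 1) * meanY r) = 0.
  apply: H => //.
    by move=> s sD; rewrite derive1E; exact: (@derive_val _ _ _ _ _ _ _ (dG s sD)).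
  move=> s; rewrite in_itv/= => /andP[s0 s1].
  have s01 : 0 <= s <= 1 by rewrite !ltW.
  have k (x : R) : (fun _ : R => x) t @[t --> s] --> x by exact: cvg_cst.
  rewrite /continuous_at /f; apply: cvgD; apply: cvgM.
  - exact: c1.
  - apply: cvgD; apply: cvgM.
    + exact: c2.
    + by apply: cvgM => //; apply: cvgM => //; exact: cc.
    + exact: cc.
    + by apply: cvgN; apply: cvgM => //; exact: c2.
  - by apply: cvgM; [exact: c2|exact: cc].
  - by apply: cvgM => //; exact: c1.
lra.
Qed.

End beta_mean.

(** * Sign of the derivative *)

Section sign.
Variable R : realType.
Implicit Types (f g h : R -> R) (e r s m x y : R).
Notation mu := (@lebesgue_measure R).
Notation D := (`]0, 1[%classic : set R).

Lemma ler_powR_neg x y e : 0 < x -> x <= y -> e <= 0 -> y `^ e <= x `^ e.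
Proof.
move=> x0 xy e0; have y0 := lt_le_trans x0 xy.
rewrite -[e]opprK !(powRN _ (- e)) lef_pV2 ?posrE ?powR_gt0//.
by rewrite ge0_ler_powR ?nnegrE ?oppr_ge0// ltW.
Qed.

Lemma Bernoulli_powR r e : 1 <= r -> 1 <= e -> 1 + e * (r - 1) <= r `^ e.
Proof.
move=> r1 e1; pose h x := x `^ e - (1 + e * (x - 1)); pose dh x := e * x `^ (e - 1) - e.
rewrite -subr_ge0 -/(h r); apply: (@ge0_of_derive_ge0 _ h dh 1 r r1).
- by rewrite /h powR1; ring.
- move=> x /andP[x1 _]; have x0 : 0 < x by exact: lt_le_trans x1.
  apply: is_deriveB; first exact: is_derive1_powR.
  have -> : (fun r => 1 + e * (r - 1)) = (fun r => e * r) \+ cst (1 - e).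
    by apply/funext => t /=; ring.
  rewrite -[X in is_derive _ _ _ X]addr0; apply: is_deriveD.
  by rewrite -[X in is_derive _ _ _ X]mulr1; exact: is_deriveZ.
- move=> x /andP[x1 _] _; rewrite subr_ge0 ler_peMr ?(le_trans ler01 e1)//.
  have : x `^ 0 <= x `^ (e - 1) by rewrite ler_powR ?subr_ge0// ltW.
  by rewrite powRr0.
Qed.

(* [sinh ((2m-1) t) <= (2m-1) sinh t] for [r = exp (2t)]. *)
Lemma powR_gap m r : 2^-1 <= m <= 1 -> 1 <= r ->
  r `^ m <= (2 * m - 1) * (r - 1) + r `^ (1 - m).
Proof.
move=> /andP[m2 m1] r1.
have dp e x : 1 <= x -> is_derive x 1 (@powR R ^~ e) (e * x `^ (e - 1)).
  by move=> x1; apply: is_derive1_powR; exact: lt_le_trans x1.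
(* The derivative of the difference is [0] at [1], and its own derivative
   [m (1 - m) (y^(m-2) - y^(-m-1))] is nonnegative because [1/2 <= m <= 1]. *)
have h0 x : 1 <= x -> 0 <= (2 * m - 1) + (1 - m) * x `^ (1 - m - 1) - m * x `^ (m - 1).
  move=> x1.
  pose k y := (2 * m - 1) + (1 - m) * y `^ (1 - m - 1) - m * y `^ (m - 1).
  pose dk y := 0 + (1 - m) * ((1 - m - 1) * y `^ (1 - m - 1 - 1)) - m * ((m - 1) * y `^ (m - 1 - 1)).
  rewrite -/(k x); apply: (@ge0_of_derive_ge0 _ k dk 1 x x1).
  - by rewrite /k !powR1; ring.
  - move=> y /andP[y1 _]; apply: is_deriveB; last by apply: is_deriveZ; exact: dp.
    by apply: is_deriveD; apply: is_deriveZ; exact: dp.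
  - move=> y /andP[y1 _] _.
    have -> : dk y = m * (1 - m) * (y `^ (m - 1 - 1) - y `^ (1 - m - 1 - 1)) by rewrite /dk; ring.
    apply: mulr_ge0; first by apply: mulr_ge0; lra.
    by rewrite subr_ge0 ler_powR//; lra.
pose h x := ((2 * m - 1) * (x - 1) + x `^ (1 - m)) - x `^ m.
pose dh x := (2 * m - 1) + (1 - m) * x `^ (1 - m - 1) - m * x `^ (m - 1).
rewrite -subr_ge0 -/(h r); apply: (@ge0_of_derive_ge0 _ h dh 1 r r1).
- by rewrite /h !powR1; ring.
- move=> x /andP[x1 _]; apply: is_deriveB; last exact: dp.
  apply: is_deriveD; last exact: dp.
  have -> : (fun r => (2 * m - 1) * (r - 1)) = (fun r => (2 * m - 1) * r) \+ cst (- (2 * m - 1)).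
    by apply/funext => t /=; ring.
  rewrite -[X in is_derive _ _ _ X]addr0; apply: is_deriveD.
  by rewrite -[X in is_derive _ _ _ X]mulr1; exact: is_deriveZ.
- by move=> x /andP[x1 _] _; apply: h0; exact: ltW.
Qed.

Variables a b : R.
Hypotheses (a0 : 0 < a) (a1 : a < 1) (b0 : 0 < b).
Notation P := (meanP R a b).
Notation Q := (meanQ R a b).

(* Has the sign of the derivative of [log_ratio m] at [r]. *)
Definition gap m r := r * P r - r `^ m * Q r.

Lemma gap1 m : gap m 1 = 0.
Proof. by rewrite /gap powR1 !mul1r meanPQ1// subrr. Qed.

Lemma gap_anti m m' r : 1 <= r -> m <= m' -> gap m' r <= gap m r.
Proof.
move=> r1 mm'; rewrite lerD2l lerN2 ler_wpM2r ?ler_powR//.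
by rewrite ltW// meanQ_gt0// (lt_le_trans ltr01).
Qed.

Lemma gap_anti_lt m m' r : 1 < r -> m < m' -> gap m' r < gap m r.
Proof.
move=> r1 mm'; have r0 : 0 < r by exact: lt_trans r1.
rewrite ltrD2l ltrN2 ltr_pM2r ?meanQ_gt0// /powR gt_eqF// ltr_expR ltr_pM2r//.
exact: ln_gt0.
Qed.

Definition gap_source m r := (a - m) * r `^ m * (r - 1) + b * (r - r `^ m) * (1 + r `^ m).

(** The raw product-rule form, still containing [meanY]. *)
Definition gap_deriv m r :=
  r `^ (- a) * ((P r + r * ((a - 1) * ((P r - meanY R a b r) / r))) -
    (m * r `^ (m - 1) * Q r + r `^ m * ((a - 1) * meanY R a b r))) +
  (- a * r `^ (- a - 1)) * gap m r.

Lemma is_derive_gap m r : 0 < r ->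
  is_derive r 1 (fun r => r `^ (- a) * gap m r) (gap_deriv m r).
Proof.
move=> r0.
have dP := is_derive_meanP R a b b0 r r0.
have dQ := is_derive_meanQ R a b b0 r r0.
have h1 : is_derive r 1 (fun r => r * P r) _ := is_deriveM (is_derive_id r 1) dP.
have h2 : is_derive r 1 (fun r => r `^ m * Q r) _ := is_deriveM (is_derive1_powR m r0) dQ.
have h3 : is_derive r 1 (gap m) _ := is_deriveB h1 h2.
have h4 : is_derive r 1 (fun r => r `^ (- a) * gap m r) _ :=
  is_deriveM (is_derive1_powR (- a) r0) h3.
by apply: (is_derive_eq h4); rewrite /gap_deriv /GRing.scale/=; ring.
Qed.

(** [meanQP] is solved for [meanY], which divides by [(1 - a) (r - 1)]; the result is a linear
    equation for [gap] with source [Q * gap_source]. *)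
Lemma gap_derivE m r : 1 < r -> gap_deriv m r =
  r `^ (- a) / (r * (r - 1)) * (- (b * (1 + r `^ m)) * gap m r + Q r * gap_source m r).
Proof.
move=> r1; have r0 : 0 < r by exact: lt_trans r1.
have rm : r - 1 != 0 by rewrite subr_eq0 gt_eqF.
have rn : r != 0 by rewrite gt_eqF.
have an : 1 - a != 0 by rewrite subr_eq0 gt_eqF.
have YE : meanY R a b r = b * (Q r - P r) / ((1 - a) * (r - 1)).
  by rewrite meanQP//; field; rewrite rm an.
have pE e : r `^ (e - 1) = r `^ e / r by rewrite (powRS _ r e)// mulrC mulKf.
rewrite /gap_deriv /gap_source /gap YE !pE; field; rewrite rn rm an //.
Qed.

Let coef_ge0 x : 1 < x -> 0 <= x `^ (- a) / (x * (x - 1)).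
Proof.
move=> x1; rewrite divr_ge0 ?powR_ge0// mulr_ge0 ?subr_ge0 ?(ltW x1)//.
exact: le_trans (ltW x1).
Qed.

Let Q_ge0 x : 1 < x -> 0 <= Q x.
Proof. by move=> x1; rewrite ltW// meanQ_gt0//; exact: lt_trans x1. Qed.

Let coefN_le0 m x : - (b * (1 + x `^ m)) <= 0.
Proof. by rewrite oppr_le0 mulr_ge0 ?addr_ge0 ?powR_ge0// ltW. Qed.

(** Wherever [gap] is negative, its term in the differential equation is nonnegative and so is the
    source; hence [r^-a gap], which starts from [0], cannot become negative. *)
Lemma gap_ge0 m r : 1 <= r -> (forall x, 1 < x <= r -> 0 <= gap_source m x) -> 0 <= gap m r.
Proof.
move=> r1 S0; have r0 : 0 < r by exact: lt_le_trans r1.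
pose h x := x `^ (- a) * gap m x.
rewrite -(@pmulr_rge0 _ (r `^ (- a))) ?powR_gt0//.
rewrite -/(h r); apply: (@ge0_of_derive_ge0 _ h (gap_deriv m) 1 r r1).
- by rewrite /h gap1 mulr0.
- by move=> x /andP[x1 _]; apply: is_derive_gap; exact: lt_le_trans x1.
- move=> x xr; have /andP[x1 _] := xr; have x0 : 0 < x by exact: lt_trans x1.
  rewrite /h pmulr_rlt0 ?powR_gt0// => g0; rewrite gap_derivE//.
  apply: mulr_ge0; first exact: coef_ge0.
  apply: addr_ge0; first exact: mulr_le0 (coefN_le0 _ _) (ltW g0).
  by apply: mulr_ge0; [exact: Q_ge0|exact: S0].
Qed.

Lemma gap_le0 m r : 1 <= r -> (forall x, 1 < x <= r -> gap_source m x <= 0) -> gap m r <= 0.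
Proof.
move=> r1 S0; have r0 : 0 < r by exact: lt_le_trans r1.
pose h x := - (x `^ (- a) * gap m x).
rewrite -(@pmulr_rle0 _ (r `^ (- a))) ?powR_gt0// -oppr_ge0.
rewrite -/(h r); apply: (@ge0_of_derive_ge0 _ h (fun r => - gap_deriv m r) 1 r r1).
- by rewrite /h gap1 mulr0 oppr0.
- by move=> x /andP[x1 _]; apply: is_deriveN; apply: is_derive_gap; exact: lt_le_trans x1.
- move=> x xr; have /andP[x1 _] := xr; have x0 : 0 < x by exact: lt_trans x1.
  rewrite /h oppr_lt0 pmulr_rgt0 ?powR_gt0// => g0.
  rewrite oppr_ge0 gap_derivE//.
  apply: mulr_ge0_le0; first exact: coef_ge0.
  rewrite -oppr_ge0 opprD; apply: addr_ge0; rewrite oppr_ge0.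
    exact: mulr_le0_ge0 (coefN_le0 _ _) (ltW g0).
  by apply: mulr_ge0_le0; [exact: Q_ge0|exact: S0].
Qed.

(** This grouping isolates the critical order [m = a + b], for which the first summand
    disappears. *)
Lemma gap_sourceE m r : gap_source m r =
  (a + b - m) * r `^ m * (r - 1) + b * (r - r `^ m * r `^ m).
Proof. by rewrite /gap_source; ring. Qed.

Hypothesis hab : 1 / 2 <= a + b.

Let m0_den : 0 < 1 + 2 * b. Proof. by rewrite addr_gt0 ?mulr_gt0. Qed.

(** The slope of [gap_source m] at [r = 1] is [(a + b - m) + b (1 - 2 m)]; [m0] is its zero. *)
Let m0_eq : a + b - m0 a b = b * (2 * m0 a b - 1).
Proof. by rewrite /m0; field; rewrite gt_eqF. Qed.

(** After clearing the denominator this is exactly [1 / 2 <= a + b]. *)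
Lemma m0_ge_half : 2^-1 <= m0 a b.
Proof. by rewrite /m0 ler_pdivlMr//; have := hab; lra. Qed.

Lemma m0_lt1 : m0 a b < 1.
Proof. by rewrite /m0 ltr_pdivrMr//; have := a1; lra. Qed.

Lemma m0_leD : m0 a b <= a + b.
Proof.
by rewrite -subr_ge0 m0_eq mulr_ge0 ?(ltW b0)// subr_ge0; have := m0_ge_half; lra.
Qed.

(** Monotonicity in [m] leaves the case [m = m0], where by [m0_eq] the source is [b x^m0] times the
    difference estimated in [powR_gap]. *)
Lemma gap_ge0_le_m0 m r : m <= m0 a b -> 1 <= r -> 0 <= gap m r.
Proof.
move=> mm0 r1; apply: le_trans (gap_anti _ _ _ r1 mm0).
apply: gap_ge0 => // x /andP[x1 _]; have x0 : 0 < x by exact: lt_trans x1.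
rewrite gap_sourceE m0_eq; set m' := m0 a b.
have xE : x `^ m' * x `^ (1 - m') = x.
  by rewrite -powRD ?subrKC ?powRr1 ?(ltW x0)// (gt_eqF x0) implybT.
have -> : b * (2 * m' - 1) * x `^ m' * (x - 1) + b * (x - x `^ m' * x `^ m') =
   b * x `^ m' * ((2 * m' - 1) * (x - 1) + x `^ (1 - m') - x `^ m').
  by rewrite -{3}xE; ring.
rewrite mulr_ge0 ?mulr_ge0 ?powR_ge0 ?(ltW b0)// subr_ge0 powR_gap ?(ltW x1)//.
by rewrite m0_ge_half ltW ?m0_lt1.
Qed.

(** An order [m'] strictly between [m0] and [m] has a nonpositive source near [1], so [gap m' <= 0]
    there; passing from [m'] to [m] makes the inequality strict. *)
Lemma gap_lt0_gt_m0 m : m0 a b < m ->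
  exists2 r1, 1 < r1 & forall r, 1 < r <= r1 -> gap m r < 0.
Proof.
move: (a0) (a1) (b0) (hab) => a0' a1' b0' hab'.
move=> m0m; pose m' := (m0 a b + m) / 2; have m0m' : m0 a b < m' by rewrite /m'; lra.
have m'm : m' < m by rewrite /m'; lra.
have c2 := m0_ge_half; have cE := m0_eq.
(* By Bernoulli's inequality with exponent [2 m' >= 1], the source at [x] is at most [(x - 1) k x],
   and [k 1 < 0] because [m0 < m']. *)
pose k x : R := (a + b - m') * x `^ m' + b * (1 - 2 * m').
have k1 : k 1 < 0 by rewrite /k powR1; nra.
have : {for 1, continuous k}.
  apply: cvgD; last exact: cvg_cst.
  apply: cvgM; first exact: cvg_cst.
  exact: is_derive_continuous (is_derive1_powR m' ltr01).
move/cvgr_lt => /(_ _ k1)[e /= e0 He].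
exists (1 + e / 2); first by lra.
move=> r /andP[r1 re]; apply: (lt_le_trans (gap_anti_lt _ _ _ r1 m'm)).
apply: gap_le0; first exact: ltW.
move=> x /andP[x1 xr]; have x0 : 0 < x by exact: lt_trans x1.
have kx : k x < 0 by apply: He; rewrite /ball/= distrC ger0_norm; lra.
have B : 1 + 2 * m' * (x - 1) <= x `^ m' * x `^ m'.
  have -> : x `^ m' * x `^ m' = x `^ (2 * m').
    by rewrite -powRD ?(gt_eqF x0) ?implybT//; congr (_ `^ _); ring.
  by apply: Bernoulli_powR; lra.
rewrite gap_sourceE.
have : k x * (x - 1) <= 0 by apply: mulr_le0_ge0; rewrite ?subr_ge0 ltW.
by rewrite /k; nra.
Qed.

(** It suffices to treat [m = min(1, a + b)]. For [m = 1] the source is [- (1 - a) x (x - 1)]; for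
    [m = a + b] it is [b (x - x^(2 (a + b)))], with [2 (a + b) >= 1]. *)
Lemma gap_le0_ge_min m r : 1 <= r -> Num.min 1 (a + b) <= m -> gap m r <= 0.
Proof.
move: (a0) (a1) (b0) (hab) => a0' a1' b0' hab'.
move=> r1 mm; apply: (le_trans (gap_anti _ _ _ r1 mm)).
apply: gap_le0 => // x /andP[x1 _]; have x0 : 0 < x by exact: lt_trans x1.
rewrite gap_sourceE; case: (leP 1 (a + b)) => h.
  rewrite powRr1 ?(ltW x0)//.
  have -> : (a + b - 1) * x * (x - 1) + b * (x - x * x) = - ((1 - a) * (x * (x - 1))) by ring.
  by rewrite oppr_le0 !mulr_ge0 ?subr_ge0 ?(ltW x0) ?(ltW x1) ?(ltW a1').
rewrite subrr !mul0r add0r; apply: mulr_ge0_le0; rewrite ?(ltW b0)// subr_le0.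
rewrite -powRD ?(gt_eqF x0) ?implybT// le1r_powR ?(ltW x1)//; lra.
Qed.

(* With [u = chord r s], for [r] large: [u^(a-1) <= (s r)^(-k) (1-s)^(a-1+k)] bounds [Q], where
   [max(0, m-a) < k < min(b, 1-a)], and [u <= r] bounds [P] from below. *)
Lemma gap_gt0_lt_min m : m < Num.min 1 (a + b) ->
  exists2 r1, 1 <= r1 & forall r, r1 < r -> 0 < gap m r.
Proof.
move: (a0) (a1) (b0) (hab) => a0' a1' b0' hab'.
rewrite lt_min => /andP[m1 mab].
(* The midpoint of an interval that is nonempty because [0 < b], [a < 1], [m < a + b] and
   [m < 1]. *)
pose k := (Num.max 0 (m - a) + Num.min b (1 - a)) / 2.
have [k0 kma kb ka] : [/\ 0 <= k, m - a < k, k < b & k < 1 - a].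
  rewrite /k; case: (leP 0 (m - a)) => h1; case: (leP b (1 - a)) => h2; split; lra.
pose g s : R := s `^ (b - k - 1) * (1 - s) `^ (b - 1).
have gi : mu.-integrable D (EFin \o g) by apply: integrable_beta => //; rewrite subr_gt0.
have wi : mu.-integrable D (EFin \o beta_weight R b) by exact: integrable_beta.
have swi := integrable_mul_id _ _ wi; have twi := integrable_mul_onem _ _ wi.
pose p0 := Rintegral mu D (fun s => s * beta_weight R b s).
pose q0 := Rintegral mu D g.
have p00 : 0 < p0.
  have : 0 < P 1 by exact: meanP_gt0.
  congr (0 < fine _); apply: eq_integral => s _; congr EFin.
  have -> : chord R 1 s = 1 by rewrite /chord; ring.
  by rewrite powR1 mul1r.
have q00 : 0 <= q0 by apply: Rintegral_ge0 => s _; rewrite mulr_ge0 ?powR_ge0.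
have hP r : 1 < r -> r `^ (a - 1) * p0 <= P r.
  move=> r1; have r0 : 0 < r by exact: lt_trans r1.
  rewrite -RintegralZl//; apply: le_Rintegral => //.
  - exact: integrableZ_EFin.
  - exact: integrable_chord.
  - move=> s Ds; have c0 := chord_gt0 _ _ _ r0 Ds; move: (Ds); rewrite /= in_itv/= => /andP[s0 s1].
    rewrite ler_wpM2r ?mulr_ge0 ?(ltW s0) ?powR_ge0//.
    by apply: ler_powR_neg => //; [rewrite /chord; nra|lra].
have hQ r : 1 < r -> Q r <= r `^ (- k) * q0.
  move=> r1; have r0 : 0 < r by exact: lt_trans r1.
  rewrite -RintegralZl//; apply: le_Rintegral => //.
  - exact: integrable_chord.
  - exact: integrableZ_EFin.
  - move=> s Ds; have c0 := chord_gt0 _ _ _ r0 Ds; move: (Ds); rewrite /= in_itv/= => /andP[s0 s1].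
    have t0 : 0 < 1 - s by rewrite subr_gt0.
    have -> : chord R r s `^ (a - 1) = chord R r s `^ (- k) * chord R r s `^ (a - 1 + k).
      by rewrite -powRD ?(gt_eqF c0) ?implybT//; congr (_ `^ _); ring.
    have e1 : chord R r s `^ (- k) <= s `^ (- k) * r `^ (- k).
      rewrite -powRM ?(ltW s0) ?(ltW r0)//; apply: ler_powR_neg; rewrite ?mulr_gt0//; last by lra.
      by rewrite /chord; lra.
    have e2 : chord R r s `^ (a - 1 + k) <= (1 - s) `^ (a - 1 + k).
      by apply: ler_powR_neg => //; [rewrite /chord; nra|lra].
    (* The factor [1 - s] of the integrand of [Q] compensates the negative exponent [a - 1 + k]. *)
    have e3 : (1 - s) `^ (a - 1 + k) * (1 - s) <= 1.
      have -> : (1 - s) `^ (a - 1 + k) * (1 - s) = (1 - s) `^ (a + k).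
        by rewrite (powRS _ (1 - s) (a + k))// mulrC; congr (_ * _ `^ _); ring.
      have : (1 - s) `^ (a + k) <= (1 - s) `^ 0 by apply: ger_powR; [rewrite t0; lra|lra].
      by rewrite powRr0.
    rewrite /g /beta_weight.
    have -> : s `^ (b - k - 1) = s `^ (- k) * s `^ (b - 1).
      by rewrite -powRD ?(gt_eqF s0) ?implybT//; congr (_ `^ _); ring.
    have e4 : chord R r s `^ (- k) * chord R r s `^ (a - 1 + k) <=
        s `^ (- k) * r `^ (- k) * (1 - s) `^ (a - 1 + k).
      by rewrite ler_pM ?powR_ge0.
    have W0 : 0 <= s `^ (b - 1) * (1 - s) `^ (b - 1) by rewrite mulr_ge0 ?powR_ge0.
    have K0 : 0 <= s `^ (- k) * r `^ (- k) by rewrite mulr_ge0 ?powR_ge0.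
    set W := s `^ (b - 1) * (1 - s) `^ (b - 1) in W0 *.
    apply: (@le_trans _ _ (s `^ (- k) * r `^ (- k) * (1 - s) `^ (a - 1 + k) * ((1 - s) * W))).
      by rewrite ler_wpM2r// mulr_ge0// ltW.
    have -> : s `^ (- k) * r `^ (- k) * (1 - s) `^ (a - 1 + k) * ((1 - s) * W) =
      (s `^ (- k) * r `^ (- k) * W) * ((1 - s) `^ (a - 1 + k) * (1 - s)) by ring.
    have -> : r `^ (- k) * (s `^ (- k) * s `^ (b - 1) * (1 - s) `^ (b - 1)) =
      s `^ (- k) * r `^ (- k) * W * 1 by rewrite /W; ring.
    by rewrite ler_wpM2l// mulr_ge0.
pose d := a + k - m; have d0 : 0 < d by rewrite /d; lra.
(* Beyond [K^(1/d)] one has [r^d > q0 / p0], that is [r^(m-k) q0 < r^a p0]; the summand [1] keeps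
   the threshold at least [1]. *)
pose K := q0 / p0 + 1; have K1 : 1 <= K by rewrite lerDr divr_ge0// ltW.
have K0 : 0 < K by exact: lt_le_trans K1.
exists (K `^ d^-1).
  by rewrite -(powRr0 K) ler_powR// invr_ge0 ltW.
move=> r Kr; have r1 : 1 < r.
  by apply: le_lt_trans Kr; rewrite -(powRr0 K) ler_powR// invr_ge0 ltW.
have r0 : 0 < r by exact: lt_trans r1.
have rK : K < r `^ d.
  have -> : K = (K `^ d^-1) `^ d by rewrite -powRrM mulVf ?gt_eqF// powRr1// ltW.
  by apply: gt0_ltr_powR => //; rewrite nnegrE ?powR_ge0// ltW.
have : q0 < p0 * r `^ d.
  have : q0 / p0 < r `^ d by move: rK; rewrite /K; lra.
  by rewrite ltr_pdivrMr// mulrC.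
move=> qp; rewrite /gap subr_gt0.
apply: (@le_lt_trans _ _ (r `^ m * (r `^ (- k) * q0))).
  by rewrite ler_wpM2l ?powR_ge0 ?hQ.
apply: (@lt_le_trans _ _ (r * (r `^ (a - 1) * p0))); last by rewrite ler_wpM2l ?(ltW r0) ?hP.
have pD x y : r `^ (x + y) = r `^ x * r `^ y by rewrite powRD// (gt_eqF r0) implybT.
rewrite !mulrA -(powRS _ r a)// -pD.
have -> : r `^ a = r `^ (m + - k) * r `^ d by rewrite -pD /d; congr (_ `^ _); ring.
by rewrite -mulrA ltr_pM2l ?powR_gt0// mulrC.
Qed.

End sign.

(** * Majorization of pairs *)

Section gamma.
Variable R : realType.
Implicit Types p t : R.
Notation mu := (@lebesgue_measure R).
Notation E := (`]0, +oo[%classic : set R).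

(** The inequality [1 + z <= expR z] at [z = t / (2 p)], raised to the power [p]. *)
Lemma powR_le_expR p t : 0 < p -> 1 <= t -> t `^ (p - 1) <= (2 * p) `^ p * expR (t / 2).
Proof.
move=> p0 t1; have t0 : 0 < t by exact: lt_le_trans t1.
have q0 : 0 < 2 * p by rewrite mulr_gt0.
apply: (@le_trans _ _ (t `^ p)); first by rewrite ler_powR//; lra.
have -> : expR (t / 2) = expR (t / (2 * p)) `^ p.
  rewrite -expRM; congr expR; field; rewrite gt_eqF//.
rewrite -powRM ?expR_ge0 ?(ltW q0)//; apply: ge0_ler_powR; rewrite ?nnegrE ?(ltW p0) ?(ltW t0)//.
  by rewrite mulr_ge0 ?expR_ge0 ?(ltW q0).
have H := expR_ge1Dx (t / (2 * p)).
have tE : t = 2 * p * (t / (2 * p)) by field; rewrite gt_eqF.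
by rewrite [leLHS]tE ler_pM2l//; lra.
Qed.

Lemma integrable_Gamma p : 0 < p ->
  mu.-integrable E (EFin \o (fun t => t `^ (p - 1) * expR (- t))).
Proof.
move=> p0; have h2 : 0 < (2^-1 : R) by rewrite invr_gt0.
have mE : measurable E by [].
pose g1 := (fun t => t `^ (p - 1)) \_ `]0, 1[.
have g1i : mu.-integrable E (EFin \o g1).
  rewrite -restrict_EFin; apply/integrable_restrict => //.
  rewrite setIidr; first exact: integrable_powRB1.
  by move=> t /=; rewrite !in_itv/= => /andP[->].
(* On [[1, +oo[] the integrand is compared with the exponential density of rate [1/2]; the factor
   [2] cancels its leading [1/2]. *)
pose c := (2 * p) `^ p * 2.
have g2i : mu.-integrable E (EFin \o (exponential_pdf (2^-1 : R))).
  by apply: integrableS (integrable_exponential_pdf h2).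
have gi : mu.-integrable E (EFin \o (fun t => g1 t + c * exponential_pdf 2^-1 t)).
  by apply: integrableD_EFin => //; exact: integrableZ_EFin.
apply: (le_integrable _ _ _ gi) => //.
  apply/measurable_EFinP; apply: measurable_funTS; apply: measurable_funM.
    exact: measurable_powR.
  by apply: measurableT_comp => //; exact: measurable_funN.
move=> t; rewrite /= in_itv/= andbT => t0.
have c0 : 0 <= c by rewrite mulr_ge0 ?powR_ge0.
have e0 : 0 <= c * exponential_pdf 2^-1 t.
  by rewrite mulr_ge0// exponential_pdf_ge0// ltW.
have g10 : 0 <= g1 t by rewrite /g1; apply: restrict_ge0 => s _; exact: powR_ge0.
rewrite lee_fin !ger0_norm ?mulr_ge0 ?powR_ge0 ?expR_ge0 ?addr_ge0//.
have [t1|t1] := ltP t 1.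
  rewrite ler_wpDr// /g1 patchE ifT; last by rewrite inE/= in_itv/= t0.
  by rewrite ler_piMr ?powR_ge0// -expR0 ler_expR; lra.
rewrite ler_wpDl// exponential_pdfE ?(ltW t0)//.
apply: (le_trans (ler_wpM2r (expR_ge0 (- t)) (powR_le_expR p t p0 t1))).
rewrite -mulrA -expRD /c.
have -> : t / 2 - t = - 2^-1 * t by field.
by rewrite -mulrA (mulrA 2) divff// mul1r.
Qed.

Lemma Gammaf_gt0 p : 0 < p -> 0 < Gammaf p.
Proof.
move=> p0; apply: Rintegral_gt0 => //.
- by rewrite lebesgue_measure_itv/= ltry oppr0 addye// ltry.
- exact: integrable_Gamma.
- by move=> t; rewrite /= in_itv/= andbT => t0; rewrite mulr_gt0 ?powR_gt0 ?expR_gt0.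
Qed.

Lemma Betaf_gt0 p q : 0 < p -> 0 < q -> 0 < Betaf p q.
Proof. by move=> p0 q0; rewrite /Betaf !mulr_gt0 ?invr_gt0 ?Gammaf_gt0 ?addr_gt0. Qed.

End gamma.

(** * Majorization in dimension two *)

Section majorization2.
Variable R : realType.

Lemma decr_rearr2 (u : 'I_2 -> R) : decr_rearr u =
  [:: Num.max (u ord0) (u ord_max); Num.min (u ord0) (u ord_max)].
Proof.
rewrite /decr_rearr; have -> : enum 'I_2 = [:: ord0; ord_max].
  by apply: (inj_map val_inj); rewrite val_enum_ord.
by rewrite maxC minC /sort /=; case: (leP (u ord_max) (u ord0)).
Qed.

Lemma majorized2 (u v : 'I_2 -> R) : majorized u v <->
  Num.max (u ord0) (u ord_max) <= Num.max (v ord0) (v ord_max) /\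
  u ord0 + u ord_max = v ord0 + v ord_max.
Proof.
have S2 (f : 'I_2 -> R) : \sum_(i < 2) f i = f ord0 + f ord_max.
  by rewrite !big_ord_recl big_ord0 addr0; congr (_ + f _); exact: val_inj.
rewrite /majorized !S2; split => -[H1 H2]; split => //.
  by have := H1 1%N isT; rewrite !big_ord_recl !big_ord0 !decr_rearr2 !addr0.
move=> [|[|k]]// _; by rewrite !big_ord_recl !big_ord0 !decr_rearr2 !addr0.
Qed.

End majorization2.

(** * Reduction of Schur convexity to monotonicity in the ratio *)

Section reduction.
Variable R : realType.
Implicit Types (e c m x y r : R).

(** For [m < 0] the power decreases and the division by [m] reverses the order again. *)
Lemma fpow_lt m x y : 0 < x -> x < y -> fpow m x < fpow m y.
Proof.
move=> x0 xy; have y0 := lt_trans x0 xy; rewrite /fpow; case: ifPn => [mN0|_]; last by rewrite ltr_ln.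
have lxy : ln x < ln y by rewrite ltr_ln.
rewrite /powR !gt_eqF//; move: mN0; rewrite neq_lt => /orP[m0|m0].
  by rewrite ltr_nM2r ?invr_lt0// ltrD2r ltr_expR ltr_nM2l.
by rewrite ltr_pM2r ?invr_gt0// ltrD2r ltr_expR ltr_pM2l.
Qed.

Lemma fpow_le m x y : 0 < x -> 0 < y -> (fpow m x <= fpow m y) = (x <= y).
Proof.
move=> x0 y0; have [xy|yx|->] := ltgtP x y.
- by rewrite ltW// fpow_lt.
- by apply/negP/negP; rewrite -ltNge fpow_lt.
- by rewrite lexx.
Qed.

Lemma fpow_max m x y : 0 < x -> 0 < y ->
  Num.max (fpow m x) (fpow m y) = fpow m (Num.max x y).
Proof.
move=> x0 y0; have [xy|yx] := leP x y; first by apply/max_idPr; rewrite fpow_le.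
by apply/max_idPl; rewrite fpow_le// ltW.
Qed.

(* Logarithm of the power mean of order [m] of [r] and [1]. *)
Definition log_mean m r : R := if m != 0 then ln ((r `^ m + 1) / 2) / m else ln r / 2.

Lemma is_derive_log_mean m r : 0 < r ->
  is_derive r 1 (log_mean m) (r `^ (m - 1) / (r `^ m + 1)).
Proof.
move=> r0; have rm : 0 < r `^ m by exact: powR_gt0.
rewrite /log_mean; have [->|mN0] /= := eqVneq m 0.
  have -> : r `^ (0 - 1) / (r `^ 0 + 1) = 2^-1 * r^-1.
    by rewrite sub0r powR_inv1 ?ltW// powRr0 mulrC.
  have -> : (fun r => ln r / 2) = (fun r => 2^-1 * ln r) by apply/funext => t; rewrite mulrC.
  by apply: is_deriveZ; exact: is_derive1_ln.
have -> : (fun r => ln ((r `^ m + 1) / 2) / m) =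
  (fun r => m^-1 * (@ln R \o (fun r => 2^-1 * (r `^ m + 1))) r).
  by apply/funext => t /=; rewrite mulrC; congr (_ * ln _); rewrite mulrC.
have p0 : 0 < 2^-1 * (r `^ m + 1) by rewrite mulr_gt0 ?invr_gt0// addr_gt0.
have h : is_derive r 1 (fun r => 2^-1 * (r `^ m + 1)) (2^-1 * (m * r `^ (m - 1) + 0)).
  by apply: is_deriveZ; apply: is_deriveD; exact: is_derive1_powR.
have h2 := @is_derive1_comp _ (@ln R) (fun r => 2^-1 * (r `^ m + 1)) r _ _ (is_derive1_ln p0) h.
apply: (is_derive_eq (is_deriveZ m^-1 h2)); rewrite /GRing.scale/=.
by field; rewrite mN0 gt_eqF// addr_gt0.
Qed.

(** The sum depends on the pair only through [ln y + log_mean m (x / y)], the logarithm of the power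
    mean of [x] and [y]. *)
Lemma fpow_sum m x y : 0 < x -> 0 < y -> fpow m x + fpow m y =
  if m != 0 then (2 * expR (m * (ln y + log_mean m (x / y))) - 2) / m
  else 2 * (ln y + log_mean m (x / y)).
Proof.
move=> x0 y0; have r0 : 0 < x / y by rewrite divr_gt0.
rewrite /fpow /log_mean; case: ifPn => mN0; last first.
  by rewrite ln_div ?posrE//; field.
have q0 : 0 < ((x / y) `^ m + 1) / 2 by rewrite divr_gt0// addr_gt0// powR_gt0.
have -> : m * (ln y + ln (((x / y) `^ m + 1) / 2) / m) = m * ln y + ln (((x / y) `^ m + 1) / 2).
  by field.
rewrite expRD lnK ?posrE//.
have -> : expR (m * ln y) = y `^ m by rewrite /powR gt_eqF.
have -> : x `^ m = (x / y) `^ m * y `^ m.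
  by rewrite -powRM ?(ltW r0) ?(ltW y0)// divfK// gt_eqF.
by field.
Qed.

Lemma fpow_sum_eq m x y x' y' : 0 < x -> 0 < y -> 0 < x' -> 0 < y' ->
  fpow m x + fpow m y = fpow m x' + fpow m y' <->
  ln y + log_mean m (x / y) = ln y' + log_mean m (x' / y').
Proof.
move=> x0 y0 x'0 y'0; rewrite !fpow_sum//; case: ifPn => mN0; split => [H|-> //].
- apply: (mulfI mN0); apply: expR_inj; have /mulIf : m^-1 != 0 by rewrite invr_eq0.
  by move=> /(_ _ _ H); lra.
- by move: H; lra.
Qed.

Lemma ler_powR_scale e c x y : 0 < e -> 0 < c -> 0 < x -> 0 < y ->
  ((c * x) `^ e <= (c * y) `^ e) = (ln x <= ln y).
Proof.
move=> e0 c0 x0 y0; have cx0 := mulr_gt0 c0 x0; have cy0 := mulr_gt0 c0 y0.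
rewrite /powR (gt_eqF cx0) (gt_eqF cy0) ler_expR (ler_pM2l e0).
by rewrite !ler_ln ?posrE// (ler_pM2l c0).
Qed.

Variables a b : R.
Hypotheses (a0 : 0 < a) (a1 : a < 1) (b0 : 0 < b).

(** The integral in [M(x, y)] without its normalization, with [y^a] taken out by homogeneity. *)
Definition mean2 x y := y `^ a * meanF R a b (x / y).

Lemma mean2_gt0 x y : 0 < x -> 0 < y -> 0 < mean2 x y.
Proof. by move=> x0 y0; rewrite mulr_gt0 ?powR_gt0// meanF_gt0// divr_gt0. Qed.

Lemma mean2C x y : 0 < x -> 0 < y -> mean2 x y = mean2 y x.
Proof.
move=> x0 y0; have r0 : 0 < x / y by rewrite divr_gt0.
rewrite /mean2 -[y / x]invf_div meanF_sym// mulrA; congr (_ * _).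
rewrite powRN powRM ?invr_ge0 ?ltW// -(powR_inv1 (ltW y0)) -powRrM mulN1r powRN.
by field; rewrite !gt_eqF ?powR_gt0.
Qed.

Lemma MabE x y : 0 < x -> 0 < y -> Mab a b x y = ((Betaf b b)^-1 * mean2 x y) `^ a^-1.
Proof.
move=> x0 y0; have r0 : 0 < x / y by rewrite divr_gt0.
rewrite /Mab; congr ((_ * _) `^ _).
pose f s := y `^ a * (chord R (x / y) s `^ a * beta_weight R b s).
have wi : lebesgue_measure.-integrable `]0, 1[ (EFin \o beta_weight R b) by exact: integrable_beta.
have fi : lebesgue_measure.-integrable `]0, 1[ (EFin \o f).
  by apply: integrableZ_EFin => //; exact: integrable_chord.
have fE s : `]0, 1[%classic s ->
    f s = (s * x + (1 - s) * y) `^ a * s `^ (b - 1) * (1 - s) `^ (b - 1).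
  move=> Ds; rewrite /f mulrA -powRM ?(ltW y0) ?(ltW (chord_gt0 _ _ _ r0 Ds))//.
  rewrite /beta_weight mulrA; congr (_ `^ _ * _ * _).
  by rewrite /chord; field; rewrite gt_eqF.
rewrite Rintegral_oo_cc; last first.
  by move: fi; apply: eq_integrable => // s; rewrite inE => Ds /=; rewrite fE.
rewrite /mean2 /meanF /chord_int -RintegralZl//; last exact: integrable_chord.
by apply: eq_Rintegral => s; rewrite inE => Ds; rewrite -fE.
Qed.

(* Along a curve [f(x) + f(y) = const], [log_ratio m (x / y)] differs from the logarithm of
   [M(x, y)^a] by a constant. *)
Definition log_ratio m r := ln (meanF R a b r) - a * log_mean m r.

Lemma ln_mean2 m x y : 0 < x -> 0 < y ->
  ln (mean2 x y) = a * (ln y + log_mean m (x / y)) + log_ratio m (x / y).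
Proof.
move=> x0 y0; rewrite /mean2 lnM ?posrE ?powR_gt0 ?meanF_gt0 ?divr_gt0// ln_powR.
by rewrite /log_ratio; ring.
Qed.

Lemma Mab_le x y x' y' : 0 < x -> 0 < y -> 0 < x' -> 0 < y' ->
  (Mab a b x y <= Mab a b x' y') = (ln (mean2 x y) <= ln (mean2 x' y')).
Proof.
move=> x0 y0 x'0 y'0; have B0 : 0 < (Betaf b b)^-1 by rewrite invr_gt0 Betaf_gt0.
have ai0 : 0 < a^-1 by rewrite invr_gt0.
have V0 := mean2_gt0 _ _ x0 y0; have V'0 := mean2_gt0 _ _ x'0 y'0.
by rewrite MabE// (MabE x')// (ler_powR_scale _ _ _ _ ai0 B0 V0 V'0).
Qed.

(** Since [F = r P + Q], the derivative of [log_ratio m] is [a / (r F (r^m + 1))] times [gap]. The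
    mean value form serves both weak and strict monotonicity. *)
Lemma log_ratio_MVT m r r' : 1 <= r -> r < r' -> exists c k : R,
  [/\ r < c, c < r', 0 < k & log_ratio m r' - log_ratio m r = k * gap R a b m c].
Proof.
move=> r1 rr'.
pose dH x := (meanF R a b x)^-1 * (a * meanP R a b x) - a * (x `^ (m - 1) / (x `^ m + 1)).
have d x : 0 < x -> is_derive x 1 (log_ratio m) (dH x).
  move=> x0; apply: is_deriveB; last by apply: is_deriveZ; exact: is_derive_log_mean.
  exact: (@is_derive1_comp _ (@ln R) (meanF R a b) x _ _
    (is_derive1_ln (meanF_gt0 _ _ _ b0 _ x0)) (is_derive_meanF _ _ _ b0 _ x0)).
have r0 : 0 < r by exact: lt_le_trans r1.
have [||c] := @MVT _ (log_ratio m) dH r r' rr'.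
- by move=> x; rewrite in_itv/= => /andP[rx _]; apply: d; exact: lt_trans rx.
- apply: derivable_within_continuous => x; rewrite in_itv/= => /andP[rx _].
  by apply: ex_derive; apply: d; exact: lt_le_trans rx.
rewrite in_itv/= => /andP[rc cr'] ->; have c0 : 0 < c := lt_trans r0 rc.
have F0 := meanF_gt0 _ a b b0 _ c0; have p0 : 0 < c `^ m + 1 by rewrite addr_gt0 ?powR_gt0.
exists c, (a * (r' - r) / (c * meanF R a b c * (c `^ m + 1))); split => //.
  by rewrite divr_gt0 ?mulr_gt0// subr_gt0.
rewrite /dH (_ : c `^ (m - 1) = c `^ m / c); last by rewrite (powRS _ c m)// mulrC mulKf// gt_eqF.
move: F0; rewrite meanFE// /gap => F0.
by field; rewrite !gt_eqF.
Qed.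

Lemma log_ratio_le m r r' : (forall x, 1 <= x -> 0 <= gap R a b m x) ->
  1 <= r -> r <= r' -> log_ratio m r <= log_ratio m r'.
Proof.
move=> g0 r1; rewrite le_eqVlt => /predU1P[->//|rr'].
have [c [k [rc _ k0 E]]] := log_ratio_MVT m _ _ r1 rr'.
by rewrite -subr_ge0 E mulr_ge0 ?(ltW k0)// g0// (le_trans r1)// ltW.
Qed.

Lemma log_ratio_ge m r r' : (forall x, 1 <= x -> gap R a b m x <= 0) ->
  1 <= r -> r <= r' -> log_ratio m r' <= log_ratio m r.
Proof.
move=> g0 r1; rewrite le_eqVlt => /predU1P[->//|rr'].
have [c [k [rc _ k0 E]]] := log_ratio_MVT m _ _ r1 rr'.
by rewrite -subr_le0 E mulr_ge0_le0 ?(ltW k0)// g0// (le_trans r1)// ltW.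
Qed.

(** By symmetry both pairs may be put in decreasing order. With equal sums, a larger maximum forces
    a smaller minimum, hence a larger ratio; the equal sums also give the common constant [c]. *)
Lemma majorized_ratio m (x y : 'I_2 -> R) : (forall i, 0 < x i) -> (forall i, 0 < y i) ->
  majorized (fun i => fpow m (x i)) (fun i => fpow m (y i)) -> exists r r' c : R,
  [/\ 1 <= r, r <= r', ln (mean2 (x ord0) (x ord_max)) = c + log_ratio m r
    & ln (mean2 (y ord0) (y ord_max)) = c + log_ratio m r'].
Proof.
have sorted (z : 'I_2 -> R) : (forall i, 0 < z i) -> exists p q : R,
    [/\ 0 < q, q <= p, Num.max (z ord0) (z ord_max) = p,
        fpow m (z ord0) + fpow m (z ord_max) = fpow m p + fpow m q
      & mean2 (z ord0) (z ord_max) = mean2 p q].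
  move=> z0; have [h|h] := leP (z ord0) (z ord_max).
    exists (z ord_max), (z ord0); split; [exact: z0|exact: h|reflexivity|exact: addrC|].
    by apply: mean2C; exact: z0.
  exists (z ord0), (z ord_max); split; [exact: z0|exact: ltW|reflexivity..].
move=> x0 y0 /majorized2; rewrite (fpow_max m _ _ (x0 _) (x0 _)) (fpow_max m _ _ (y0 _) (y0 _)).
have [p [q [q0 qp -> -> ->]]] := sorted x x0.
have [p' [q' [q'0 qp' -> -> ->]]] := sorted y y0.
have p0 := lt_le_trans q0 qp; have p'0 := lt_le_trans q'0 qp'.
rewrite (fpow_le m _ _ p0 p'0) => -[pp' Es].
have q'q : q' <= q.
  by rewrite -(fpow_le m _ _ q'0 q0); move: pp'; rewrite -(fpow_le m _ _ p0 p'0); lra.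
have Ec := (fpow_sum_eq m _ _ _ _ p0 q0 p'0 q'0).1 Es.
exists (p / q), (p' / q'), (a * (ln q + log_mean m (p / q))); split.
- by rewrite ler_pdivlMr// mul1r.
- by apply: ler_pM; rewrite ?invr_ge0 ?(ltW p0) ?(ltW q0) ?lef_pV2 ?posrE.
- exact: ln_mean2.
- by rewrite Ec; exact: ln_mean2.
Qed.

Lemma ratio_majorized m r r' : 1 <= r -> r <= r' -> exists x y : 'I_2 -> R,
  [/\ forall i, 0 < x i, forall i, 0 < y i,
      majorized (fun i => fpow m (x i)) (fun i => fpow m (y i)),
      ln (mean2 (x ord0) (x ord_max)) = log_ratio m r
    & ln (mean2 (y ord0) (y ord_max)) = log_ratio m r'].
Proof.
move=> r1 rr'; have r0 : 0 < r by exact: lt_le_trans r1.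
have r'0 : 0 < r' by exact: lt_le_trans rr'.
(* The scaling that gives [(t * q t, q t)] power mean [1], so that all these pairs lie on one
   curve. *)
pose q t := expR (- log_mean m t); have q0 t : 0 < q t by exact: expR_gt0.
pose v t (i : 'I_2) := if i == ord0 then t * q t else q t.
have v0 t : 0 < t -> forall i, 0 < v t i by move=> t0 i; rewrite /v; case: ifP => _; rewrite ?mulr_gt0.
have vq t : 0 < t -> t * q t / q t = t by move=> t0; rewrite mulfK// gt_eqF.
have lq t : ln (q t) = - log_mean m t by rewrite expRK.
have lnv t : 0 < t -> ln (mean2 (v t ord0) (v t ord_max)) = log_ratio m t.
  move=> t0; rewrite (ln_mean2 m) ?v0// /v/= vq// lq; ring.
exists (v r), (v r'); split; [exact: v0|exact: v0| |exact: lnv|exact: lnv].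
have Es : fpow m (r * q r) + fpow m (q r) = fpow m (r' * q r') + fpow m (q r').
  by apply/fpow_sum_eq; rewrite ?mulr_gt0// !vq// !lq; ring.
have mx t : 1 <= t -> Num.max (t * q t) (q t) = t * q t.
  by move=> t1; apply/max_idPl; rewrite ler_peMl// ltW.
apply/majorized2; split; last by rewrite /v/=.
rewrite !fpow_max ?v0// fpow_le ?lt_max ?v0// /v/= !mx//; last exact: le_trans rr'.
(* If the larger ratio had the smaller maximum, equal sums would give it the larger minimum, hence
   also the larger maximum. *)
rewrite leNgt; apply/negP => h.
have h1 : fpow m (r' * q r') < fpow m (r * q r) by apply: fpow_lt => //; rewrite mulr_gt0.
have h2 : q r < q r'.
  rewrite ltNge; apply/negP; rewrite -(fpow_le m)// => h3; move: Es h1 h3; lra.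
have : r * q r <= r' * q r' by rewrite ler_pM// ltW.
by rewrite leNgt h.
Qed.

End reduction.

(** * The sets [E+] and [E-] as half-lines in [m] *)

Section conditions.
Variables (R : realType) (a b m : R).
Hypotheses (a0 : 0 < a) (a1 : a < 1) (b0 : 0 < b) (hab : 1 / 2 <= a + b).

Lemma EplusE : Eplus a b m <-> m <= m0 a b.
Proof.
have h1 := m0_lt1 R a b a1 b0; have h2 := m0_leD R a b b0 hab.
split=> [[]//|mm0]; split => //.
have [ab1|ab1] := leP 1 (a + b); first by left; split => //; exact: le_lt_trans h1.
right; have [mab|mab] := ltP m (a + b); first by left.
(* In this boundary case [m = a + b = m0], and the formula for [m0] forces [a + b = 1/2]. *)
right; have mE : m = m0 a b by apply: le_anti; rewrite mm0 (le_trans h2).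
have abE : a + b = m0 a b by apply: le_anti; rewrite (le_trans mab).
split; first by rewrite mE.
have den : 1 + 2 * b != 0 by rewrite gt_eqF// addr_gt0 ?mulr_gt0.
have : (a + b) * (1 + 2 * b) = a + 2 * b by rewrite abE /m0 divfK.
have := b0; nra.
Qed.

(** As [m0] is below both [1] and [a + b], the condition [m0 <= m] follows from the other one. *)
Lemma EminusE : Eminus a b m <-> Num.min 1 (a + b) <= m.
Proof.
have h1 := m0_lt1 R a b a1 b0; have h2 := m0_leD R a b b0 hab.
rewrite ge_min; split.
  by move=> [_ [[_ ->]//|[[_ [-> _]]|[_ /ltW ->]]]]; rewrite ?lexx orbT.
have [ab1|ab1] := leP 1 (a + b).
  move=> /orP mm; have m1 : 1 <= m by case: mm => // /(le_trans ab1).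
  by split; [exact: le_trans (ltW h1) m1|left].
move=> /orP mm; have mab : a + b <= m by case: mm => // /(le_trans (ltW ab1)).
split; first exact: le_trans mab.
right; have [e|ne] := eqVneq m (a + b); first by left; rewrite e.
by right; split => //; rewrite lt_neqAle eq_sym ne.
Qed.

End conditions.

Theorem theorem2 (R : realType) (a b m : R)
  (ha0 : 0 < a) (ha1 : a < 1) (hb : 0 < b) (hab : 1 / 2 <= a + b) :
  (Schur_m_power_convex m (@pos_orthant R 2)
     (fun x : 'I_2 -> R => Mab a b (x ord0) (x ord_max)) <-> Eplus a b m) /\
  (Schur_m_power_concave m (@pos_orthant R 2)
     (fun x : 'I_2 -> R => Mab a b (x ord0) (x ord_max)) <-> Eminus a b m).
Proof.
rewrite (EplusE _ _ _ m ha1 hb hab) (EminusE _ _ _ m ha1 hb hab).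
have lr := log_ratio_MVT R a b ha0 hb m.
have rm := ratio_majorized R a b hb m.
have ML (x y : 'I_2 -> R) u v : (forall i, 0 < x i) -> (forall i, 0 < y i) ->
    ln (mean2 R a b (x ord0) (x ord_max)) = u -> ln (mean2 R a b (y ord0) (y ord_max)) = v ->
    (Mab a b (x ord0) (x ord_max) <= Mab a b (y ord0) (y ord_max)) = (u <= v).
  by move=> x0 y0 <- <-; exact: Mab_le.
split; split.
(* For [m > m0], [log_ratio] drops strictly from ratio [1] to a ratio [r] near [1], against
   convexity. *)
- move=> [_ cvx]; rewrite leNgt; apply/negP => m0m.
  have [r r1 g0] := gap_lt0_gt_m0 R a b ha0 ha1 hb hab m m0m.
  have [x [y [x0 y0 xy ex ey]]] := rm 1 r (lexx 1) (ltW r1).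
  have : Mab a b (x ord0) (x ord_max) <= Mab a b (y ord0) (y ord_max) := cvx x y x0 y0 xy.
  rewrite (ML _ _ _ _ x0 y0 ex ey) leNgt => /negP; apply.
  have [c [k [c1 cr k0 E]]] := lr 1 r (lexx 1) r1.
  by rewrite -subr_lt0 E pmulr_rlt0// g0// c1 ltW.
- move=> mm0; split=> [x x0 //|x y x0 y0 /(majorized_ratio R a b hb m x y x0 y0)].
  move=> [r [r' [c [r1 rr' ex ey]]]].
  change (Mab a b (x ord0) (x ord_max) <= Mab a b (y ord0) (y ord_max)).
  rewrite (ML _ _ _ _ x0 y0 ex ey) lerD2l.
  by apply: log_ratio_le => // z z1; exact: gap_ge0_le_m0.
(* Below [min(1, a + b)], [log_ratio] grows strictly between the large ratios [r] and [r + 1],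
   against concavity. *)
- move=> [_ ccv]; rewrite leNgt; apply/negP => mm.
  have [r r1 g0] := gap_gt0_lt_min R a b ha0 ha1 hb hab m mm.
  have rr : r < r + 1 by rewrite ltrDl.
  have [x [y [x0 y0 xy ex ey]]] := rm r (r + 1) r1 (ltW rr).
  have : Mab a b (y ord0) (y ord_max) <= Mab a b (x ord0) (x ord_max) := ccv x y x0 y0 xy.
  rewrite (ML _ _ _ _ y0 x0 ey ex) leNgt => /negP; apply.
  have [c [k [c1 _ k0 E]]] := lr r (r + 1) r1 rr.
  by rewrite -subr_gt0 E mulr_gt0// g0.
- move=> mm; split=> [x x0 //|x y x0 y0 /(majorized_ratio R a b hb m x y x0 y0)].
  move=> [r [r' [c [r1 rr' ex ey]]]].
  change (Mab a b (y ord0) (y ord_max) <= Mab a b (x ord0) (x ord_max)).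
  rewrite (ML _ _ _ _ y0 x0 ey ex) lerD2l.
  by apply: log_ratio_ge => // z z1; exact: gap_le0_ge_min.
Qed.
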